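(* Let $A(q) = \frac{\pi-2}{\pi^{q+1}}$ and, for $q>0$ and $x \in (0,\pi/2)$, let $$\varphi_{A(q),q}(x) = \frac{\sin x}{x} - \frac{2}{\pi} - A(q)\left(\pi^q - (2x)^q\right).$$ Let $q_1 = \frac{2}{\pi-2} = 1.75193\ldots$ and $q_2 = 2$. Then: (i) If $q \in (0, q_1]$, then for all $x \in (0, \pi/2)$ $$\frac{\sin x}{x} > \frac{2}{\pi} + A(q_1)\left(\pi^{q_1} - (2x)^{q_1}\right) \geq \frac{2}{\pi} + A(q)\left(\pi^q - (2x)^q\right),$$ and the constant $q_1$ is the best possible. (ii) If $q \in (q_1, q_2)$, then the equation $\varphi_{A(q),q}(x) = 0$ has a unique solution $x_0^{(q)}$ in $(0,\pi/2)$, and $$x \in \left(0, x_0^{(q)}\right) \Longrightarrow \frac{\sin x}{x} > \frac{2}{\pi} + A(q)\left(\pi^q - (2x)^q\right),$$ $$x \in \left(x_0^{(q)}, \frac{\pi}{2}\right) \Longrightarrow \frac{\sin x}{x} < \frac{2}{\pi} + A(q)\left(\pi^q - (2x)^q\right).$$ (iii) If $q \in [q_2, +\infty)$, then for all $x \in (0,\pi/2)$ $$\frac{\sin x}{x} < \frac{2}{\pi} + A(q_2)\left(\pi^{q_2} - (2x)^{q_2}\right) \leq \frac{2}{\pi} + A(q)\left(\pi^q - (2x)^q\right),$$ and the constant $q_2$ is the best possible. (iv) For each $q \in (q_1, q_2)$, the function $\varphi_{A(q),q}$ has exactly one maximum and exactly one minimum on $(0,\pi/2)$, at certain points $m_1^{(q)},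 m_2^{(q)} \in (0,\pi/2)$ respectively, and $m_1^{(q)} < m_2^{(q)}$. For $q = q_1$ the function $\varphi_{A(q),q}$ has exactly one maximum on $(0,\pi/2)$, and for $q = q_2$ it has exactly one minimum on $(0,\pi/2)$. (v) The equation $$\left|\varphi_{A(q),q}\left(m_1^{(q)}\right)\right| = \left|\varphi_{A(q),q}\left(m_2^{(q)}\right)\right|$$ has, for the parameter $q \in (q_1, q_2)$, the solution $q = q_0$, numerically determined as $q_0 = 1.84823\ldots$. For the value $$d_0 = \left|\varphi_{A(q_0),q_0}\left(m_1^{(q_0)}\right)\right| = \left|\varphi_{A(q_0),q_0}\left(m_2^{(q_0)}\right)\right| = 0.0026604\ldots$$ it holds $$d_0 = \inf_{q \in (0,\infty)} \ \sup_{x \in (0,\pi/2)} \left|\varphi_{A(q),q}(x)\right|.$$ Hence the minimax approximant of the family $\varphi_{A(q),q}$ ($q>0$) is $\varphi_{A(q_0),q_0}(x) = \frac{\sin x}{x} - \frac{2}{\pi} - A(q_0)\left(\pi^{q_0} - (2x)^{q_0}\right)$, which determines the corresponding minimax approximation $\frac{\sin x}{x} \approx \frac{2}{\pi} + A(q_0)\left(\pi^{q_0} - (2x)^{q_0}\right)$, with $A(q_0) = 0.043803\ldots$.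
   Context: ''Maximum'' and ''minimum'' on the open interval $(0,\pi/2)$ in (iv) mean local maximum and local minimum at an interior point. ''Best possible'' in (i) means that $q_1$ is the largest $q$ for which $\frac{\sin x}{x} > \frac{2}{\pi} + A(q)(\pi^q-(2x)^q)$ holds for all $x \in (0,\pi/2)$; in (iii) it means that $q_2$ is the smallest $q$ for which $\frac{\sin x}{x} < \frac{2}{\pi} + A(q)(\pi^q-(2x)^q)$ holds for all $x\in(0,\pi/2)$. Minimax approximant: for a family of functions $\varphi_q(x)$, $x \in (a,b)$, $q \in \mathbb{R}^+ = (0,\infty)$, if the infimum over $q$ of the error $d(q) = \sup_{x\in(a,b)}|\varphi_q(x)|$ is attained at $q = q_0 \in \mathbb{R}^+$, then $\varphi_{q_0}$ is called the minimax approximant of the family on $(a,b)$. A decimal followed by ''$\ldots$'' gives the leading digits of the decimal expansion. *)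

(* Defs.v *)
From Stdlib Require Import Reals.
From Coquelicot Require Import Coquelicot.
Open Scope R_scope.

Definition A (q : R) : R := (PI - 2) / Rpower PI (q + 1).

Definition approx (q x : R) : R :=
  2 / PI + A q * (Rpower PI q - Rpower (2 * x) q).

Definition phi (q x : R) : R :=
  sin x / x - 2 / PI - A q * (Rpower PI q - Rpower (2 * x) q).

Definition q1 : R := 2 / (PI - 2).
Definition q2 : R := 2.

Definition is_largest (E : R -> Prop) (m : R) : Prop :=
  E m /\ forall q, E q -> q <= m.

Definition is_smallest (E : R -> Prop) (m : R) : Prop :=
  E m /\ forall q, E q -> m <= q.

Definition local_max_on (a b : R) (f : R -> R) (m : R) : Prop :=
  a < m < b /\ locally m (fun y => f y <= f m).

Definition local_min_on (a b : R) (f : R -> R) (m : R) : Prop :=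
  a < m < b /\ locally m (fun y => f m <= f y).

(* The supremum of |f| over the open interval (a, b); it may be p_infty. *)
Definition sup_error (a b : R) (f : R -> R) : Rbar :=
  Lub_Rbar (fun e => exists x, a < x < b /\ e = Rabs (f x)).

Definition inf_error (a b : R) (F : R -> R -> R) : Rbar :=
  Rbar_glb (fun d => exists q, 0 < q /\ d = sup_error a b (F q)).

(* g matters only through its restriction to (a, b). *)
Definition minimax_approximant (a b : R) (F : R -> R -> R) (g : R -> R) : Prop :=
  exists q, 0 < q /\ sup_error a b (F q) = inf_error a b F /\
    forall x, a < x < b -> g x = F q x.

(* Main.v *)
Require Import Defs.
From Stdlib Require Import Reals Ranalysis5 Lra Lia Factorial.
From Stdlib Require Import QArith Qreals Qround.
From Coquelicot Require Import Coquelicot.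
Open Scope R_scope.

(** Put t = 2x/PI and c = 1 - 2/PI. Then phi q x = c t^q - (1 - sin x / x), an
    expression which tends to 0 at x = 0, vanishes at x = PI/2, and strictly
    decreases in q.

    Everything rests on the shape of this function of x. The quantity
    x phi'(x) = q c t^q - g(x), with g(x) = sin x / x - cos x, has the sign of
    q c - g(x) t^(-q), so it is enough to understand the level function
    g(x) t^(-q). Its derivative has the sign of x sin x / g(x) - (1 + q), and
    x sin x / g(x) strictly decreases on (0, PI/2) and stays below 3
    ([ratio_decreasing], [ratio_lt_3]); the monotonicity is a Wilker-type
    inequality, which follows from the Cusa-Huygens inequality
    3 sin y < y (2 + cos y). Hence the level function passes from increasing to
    decreasing at most once, and only decreases when q = 2. It therefore takes the value q c at most twice,
    and as soon as two critical points of phi q are known, phi q goes up, down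
    and up again around them ([shape_of_critical]). The critical points
    themselves come from Rolle's theorem: phi q vanishes at both ends, and for
    q1 < q < 2 also in between, because it is positive near 0 (t^q dominates
    x^2) and negative near PI/2 (there phi' has the sign of q - q1). For
    q = q1 the second critical point is PI/2, and for q = 2 there is only one,
    a minimum. The first four parts of the theorem can be read off from these
    shapes and from the monotonicity in q.

    For the last part, the maximum M(q) and the minimum -L(q) of phi q strictly
    decrease and are 1-Lipschitz in q, so M - L has exactly one zero q0 as soon
    as it changes sign. If q < q0 then phi q exceeds M(q0) at the maximum point
    of phi q0, and if q > q0 then phi q is below -L(q0) at the minimum point;
    so q0 is the only minimizer of the error, and the minimal error is M(q0).

    The decimals are obtained by comparing M and L at 1.8482343 and 1.848236.
    At a critical point m the power t^q can be eliminated: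
    q phi q m = (1 + q) sin m / m - cos m - q. So it suffices to enclose m,
    which the sign of x phi'(x) at two nearby points does. These points are
    taken as (PI/2) exp(-r) with r rational, since then t^q = exp(-qr), and the
    rest is a computation with Taylor polynomials over the rationals. *)

(** * Monotonicity and Rolle's theorem *)

Lemma lt_of_derive_pos (f f' : R -> R) (a b : R) :
  a < b -> (forall x, a <= x <= b -> is_derive f x (f' x)) ->
  (forall x, a < x < b -> 0 < f' x) -> f a < f b.
Proof.
intros hab hd hp.
destruct (MVT_cor2 f f' a b hab) as [c [hc hin]].
{ intros x hx; apply is_derive_Reals; auto. }
assert (0 < f' c * (b - a)) by (apply Rmult_lt_0_compat; [auto | lra]).
lra.
Qed.

Lemma gt_of_derive_neg (f f' : R -> R) (a b : R) :
  a < b -> (forall x, a <= x <= b -> is_derive f x (f' x)) ->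
  (forall x, a < x < b -> f' x < 0) -> f b < f a.
Proof.
intros hab hd hp.
enough (- f a < - f b) by lra.
apply (lt_of_derive_pos (fun x => - f x) (fun x => - f' x)); auto.
- intros x hx; apply (is_derive_opp f); auto.
- intros x hx; specialize (hp x hx); lra.
Qed.

Lemma le_of_derive_nonneg (f f' : R -> R) (a b : R) :
  a <= b -> (forall x, a <= x <= b -> is_derive f x (f' x)) ->
  (forall x, a <= x <= b -> 0 <= f' x) -> f a <= f b.
Proof.
intros [hab | ->] hd hp; [| lra].
destruct (MVT_cor2 f f' a b hab) as [c [hc hin]].
{ intros x hx; apply is_derive_Reals; auto. }
assert (0 <= f' c * (b - a)) by (apply Rmult_le_pos; [apply hp |]; lra).
lra.
Qed.

Lemma rolle (f f' : R -> R) (a b : R) :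
  a < b -> f a = f b -> (forall x, a <= x <= b -> is_derive f x (f' x)) ->
  exists c, a < c < b /\ f' c = 0.
Proof.
intros hab he hd.
destruct (MVT_cor2 f f' a b hab) as [c [hc hin]].
{ intros x hx; apply is_derive_Reals; auto. }
exists c; split; auto.
apply Rmult_eq_reg_r with (b - a); lra.
Qed.

Definition vanishes_at_0 (f : R -> R) : Prop :=
  forall eps, 0 < eps -> exists d, 0 < d /\ forall x, 0 < x < d -> Rabs (f x) < eps.

(** Apply the usual theorem to the extension of [f] by 0 at the origin. The
    extension is needed because the conventional value at 0 of a quotient such as
    [sin x / x] is not its limit. *)
Lemma rolle_from_0 (f f' : R -> R) (b : R) :
  0 < b -> f b = 0 -> vanishes_at_0 f ->
  (forall x, 0 < x <= b -> is_derive f x (f' x)) ->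
  exists c, 0 < c < b /\ f' c = 0.
Proof.
intros hb hfb h0 hd.
set (F := fun x => if Rlt_dec 0 x then f x else 0).
assert (hF : forall x, 0 < x -> locally x (fun y => f y = F y)).
{ intros x hx; exists (mkposreal x hx); intros y hy.
  unfold F; destruct (Rlt_dec 0 y) as [| hn]; [reflexivity | exfalso; apply hn].
  apply Rabs_lt_between' in hy; simpl in hy; lra. }
assert (hFd : forall x, 0 < x <= b -> is_derive F x (f' x)).
{ intros x hx; apply is_derive_ext_loc with f; [apply hF; lra | apply hd; lra]. }
assert (pr : forall x, 0 < x < b -> derivable_pt F x).
{ intros x hx; exists (f' x); apply is_derive_Reals, hFd; lra. }
destruct (Rolle F 0 b pr) as [c [hc he]].
- intros x [[hx | <-] hxb].
  + apply derivable_continuous_pt; exists (f' x).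
    apply is_derive_Reals, hFd; lra.
  + intros eps he; destruct (h0 eps he) as [d [hd0 hds]].
    exists d; split; auto; intros x [_ hx].
    unfold F at 2; destruct (Rlt_dec 0 0); [lra |].
    simpl in hx |- *; unfold Rdist in *; rewrite Rminus_0_r in *.
    unfold F; destruct (Rlt_dec 0 x).
    * apply hds; rewrite Rabs_pos_eq in hx; lra.
    * rewrite Rabs_R0; lra.
- exact hb.
- unfold F; destruct (Rlt_dec 0 0); [lra |]; destruct (Rlt_dec 0 b); lra.
- exists c; split; auto.
  rewrite <- he; symmetry; apply derive_pt_eq_0.
  apply is_derive_Reals, hFd; lra.
Qed.

Lemma pos_of_increasing_from_0 (f : R -> R) (m : R) :
  vanishes_at_0 f -> (forall x y, 0 < x -> x < y -> y <= m -> f x < f y) ->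
  forall x, 0 < x <= m -> 0 < f x.
Proof.
intros h0 hi x hx.
assert (h1 : f (x / 2) < f x) by (apply hi; lra).
apply Rle_lt_trans with (2 := h1).
apply Rnot_lt_le; intros hn.
destruct (h0 (- f (x / 2)) ltac:(lra)) as [d [hd hds]].
set (y := Rmin (d / 2) (x / 4)).
assert (hy : 0 < y /\ y <= d / 2 /\ y <= x / 4).
{ unfold y; repeat split; [apply Rmin_glb_lt; lra | apply Rmin_l | apply Rmin_r]. }
specialize (hds y ltac:(lra)).
apply Rabs_lt_between in hds.
assert (f y < f (x / 2)) by (apply hi; lra).
lra.
Qed.

Lemma neg_left_of_zero (f : R -> R) (l p b : R) :
  p < b -> f b = 0 -> is_derive f b l -> 0 < l -> exists x, p < x < b /\ f x < 0.
Proof.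
intros hp hb hd hl; apply is_derive_Reals in hd.
destruct (hd l hl) as [d hds].
set (h := Rmin (d / 2) ((b - p) / 2)).
assert (hh : 0 < h /\ h <= d / 2 /\ h <= (b - p) / 2).
{ assert (h0 := cond_pos d).
  unfold h; repeat split; [apply Rmin_glb_lt; lra | apply Rmin_l | apply Rmin_r]. }
assert (h0 := cond_pos d).
exists (b - h); split; [lra |].
specialize (hds (- h) ltac:(lra)).
rewrite Rabs_Ropp, Rabs_pos_eq in hds by lra; specialize (hds ltac:(lra)).
rewrite hb, Rminus_0_r in hds; apply Rabs_lt_between in hds.
change (b + - h) with (b - h) in hds.
assert (hq : 0 < f (b - h) / - h) by lra.
replace (f (b - h) / - h) with (- f (b - h) / h) in hq by (field; lra).
apply Rnot_le_lt; intros hn.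
assert (- f (b - h) / h <= 0); [apply Rle_div_l; lra | lra].
Qed.

(** * Trigonometric inequalities *)

Lemma PI_gt_3 : 3 < PI.
Proof. generalize PI2_3_2; lra. Qed.

Lemma sin_gt_x_cos x : 0 < x < PI -> x * cos x < sin x.
Proof.
intros hx.
enough (0 * cos 0 - sin 0 > x * cos x - sin x) by (rewrite sin_0 in *; lra).
apply (gt_of_derive_neg (fun x => x * cos x - sin x) (fun x => - (x * sin x))); [lra | |].
- intros y _; auto_derive; [auto | ring].
- intros y hy; assert (0 < sin y) by (apply sin_gt_0; lra); nra.
Qed.

(** With u = y/2, the derivative of the difference is 4 sin u (sin u - u cos u). *)
Lemma cusa_huygens y : 0 < y < PI -> 3 * sin y < y * (2 + cos y).
Proof.
intros hy.
enough (0 * (2 + cos 0) - 3 * sin 0 < y * (2 + cos y) - 3 * sin y)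
  by (rewrite sin_0 in *; lra).
apply (lt_of_derive_pos (fun y => y * (2 + cos y) - 3 * sin y)
  (fun y => 2 * (1 - cos y) - y * sin y)); [lra | |].
- intros x _; auto_derive; [auto | ring].
- intros x hx.
  assert (hs : 0 < sin (x / 2)) by (apply sin_gt_0; lra).
  assert (h := sin_gt_x_cos (x / 2) ltac:(lra)).
  assert (hc := cos_2a_sin (x / 2)); assert (hsn := sin_2a (x / 2)).
  replace (2 * (x / 2)) with x in hc, hsn by lra.
  rewrite hc, hsn.
  replace (2 * _ - _) with (4 * sin (x / 2) * (sin (x / 2) - x / 2 * cos (x / 2))) by field.
  apply Rmult_lt_0_compat; lra.
Qed.

(** Half the Cusa-Huygens difference at 2x is the derivative of this difference. *)
Lemma wilker_type x :
  0 < x < PI / 2 -> 2 * (sin x * sin x) < x * x + x * (sin x * cos x).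
Proof.
intros hx.
set (f := fun x => x * x + x * (sin x * cos x) - 2 * (sin x * sin x)).
enough (f 0 < f x) by (unfold f in *; rewrite sin_0 in *; lra).
apply (lt_of_derive_pos f
  (fun x => (2 * x * (2 + cos (2 * x)) - 3 * sin (2 * x)) / 2)); [lra | |].
- intros y _; unfold f; auto_derive; [auto |].
  rewrite cos_2a, sin_2a.
  field_simplify.
  assert (h := sin2_cos2 y); unfold Rsqr in h.
  nra.
- intros y hy; assert (h := cusa_huygens (2 * y) ltac:(lra)); lra.
Qed.

Lemma cos_ge x : 0 <= x -> 1 - x * x / 2 <= cos x.
Proof.
intros hx.
enough (cos 0 + 0 * 0 / 2 <= cos x + x * x / 2) by (rewrite cos_0 in *; lra).
apply (le_of_derive_nonneg (fun x => cos x + x * x / 2) (fun x => x - sin x)); auto.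
- intros y _; auto_derive; [auto | field].
- intros y [[hy | <-] _]; [generalize (sin_lt_x y hy) | rewrite sin_0]; lra.
Qed.

Lemma sinc_bounds x : 0 < x < PI -> 0 <= 1 - sin x / x <= x * x / 2.
Proof.
intros hx; assert (h1 := sin_lt_x x ltac:(lra)); assert (h2 := sin_gt_x_cos x hx).
assert (h3 := cos_ge x ltac:(lra)).
assert (sin x / x < 1) by (apply Rlt_div_l; lra).
assert (cos x < sin x / x) by (apply Rlt_div_r; lra).
lra.
Qed.

(** * The approximation error in terms of t = 2x/PI *)

Lemma c_pos : 0 < 1 - 2 / PI < 1.
Proof.
assert (h := PI_gt_3).
assert (0 < 2 / PI < 1); [split | lra].
- apply Rdiv_lt_0_compat; lra.
- apply Rlt_div_l; lra.
Qed.

Definition tpow (q x : R) : R := exp (q * ln (2 * x / PI)).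

Lemma tpow_pos q x : 0 < tpow q x.
Proof. apply exp_pos. Qed.

Lemma tpow_at_end q : tpow q (PI / 2) = 1.
Proof.
assert (h := PI_gt_3); unfold tpow.
replace (2 * (PI / 2) / PI) with 1 by (field; lra).
now rewrite ln_1, Rmult_0_r, exp_0.
Qed.

Lemma ln_t_neg x : 0 < x < PI / 2 -> ln (2 * x / PI) < 0.
Proof.
intros hx; rewrite <- ln_1; apply ln_increasing.
- apply Rdiv_lt_0_compat; lra.
- apply Rlt_div_l; lra.
Qed.

Lemma tpow_opp q x : tpow q x * tpow (- q) x = 1.
Proof.
unfold tpow; rewrite <- exp_plus, <- exp_0; f_equal; ring.
Qed.

Lemma tpow_decreasing q q' x : 0 < x < PI / 2 -> q < q' -> tpow q' x < tpow q x.
Proof.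
intros hx hq; apply exp_increasing; assert (h := ln_t_neg x hx); nra.
Qed.

(** With l = ln t < 0 this is exp(ql) - exp(q'l) <= exp(ql) (q' - q) (-l), where
    exp(ql) (-l) <= 1 because exp(-ql) >= 1 - ql >= -l. *)
Lemma tpow_lipschitz q q' x :
  0 < x < PI / 2 -> 1 <= q -> q <= q' -> tpow q x - tpow q' x <= q' - q.
Proof.
intros hx h1 hq; unfold tpow.
assert (hl := ln_t_neg x hx); set (l := ln _) in *.
assert (h2 := exp_ineq1_le ((q' - q) * l)).
replace (q' * l) with (q * l + (q' - q) * l) by ring; rewrite exp_plus.
assert (h3 : exp (q * l) * - l <= 1).
{ assert (h4 := exp_ineq1_le (- (q * l))).
  apply Rmult_le_reg_r with (exp (- (q * l))); [apply exp_pos |].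
  rewrite Rmult_1_l, Rmult_assoc, (Rmult_comm (- l)), <- Rmult_assoc, <- exp_plus.
  rewrite Rplus_opp_r, exp_0; nra. }
assert (hp := exp_pos (q * l)).
nra.
Qed.

Lemma phi_eq q x : 0 < x -> phi q x = (1 - 2 / PI) * tpow q x - (1 - sin x / x).
Proof.
intros hx; assert (h := PI_gt_3); unfold phi, A.
assert (e : Rpower PI (q + 1) = PI * Rpower PI q).
{ rewrite Rpower_plus, Rpower_1 by lra; ring. }
assert (e2 : Rpower (2 * x) q = Rpower PI q * tpow q x).
{ unfold Rpower, tpow; rewrite <- exp_plus; f_equal.
  rewrite ln_div by lra; ring. }
assert (hp : 0 < Rpower PI q) by apply exp_pos.
rewrite e, e2; field; lra.
Qed.

Lemma phi_approx q x : phi q x = sin x / x - approx q x.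
Proof. unfold phi, approx; ring. Qed.

Lemma phi_end q : phi q (PI / 2) = 0.
Proof.
assert (h := PI_gt_3); rewrite phi_eq by lra.
rewrite tpow_at_end, sin_PI2; field; lra.
Qed.

Lemma phi_decreasing q q' x : 0 < x < PI / 2 -> q < q' -> phi q' x < phi q x.
Proof.
intros hx hq; rewrite !phi_eq by lra.
assert (h := tpow_decreasing q q' x hx hq); assert (hc := c_pos); nra.
Qed.

Lemma phi_nonincreasing q q' x : 0 < x < PI / 2 -> q <= q' -> phi q' x <= phi q x.
Proof.
intros hx [hq | ->]; [left; now apply phi_decreasing | lra].
Qed.

Lemma phi_lipschitz q q' x :
  0 < x < PI / 2 -> 1 <= q -> q <= q' -> phi q x - phi q' x <= q' - q.
Proof.
intros hx h1 hq; rewrite !phi_eq by lra.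
assert (h := tpow_lipschitz q q' x hx h1 hq); assert (hc := c_pos).
nra.
Qed.

(** t^q <= t for q >= 1, and 1 - sin x / x is at most x^2/2. *)
Lemma phi_vanishes_at_0 q : 1 <= q -> vanishes_at_0 (phi q).
Proof.
intros hq eps he; assert (hPI := PI_gt_3).
exists (Rmin 1 (eps / 2)); split; [apply Rmin_glb_lt; lra |].
intros x [hx0 hx].
assert (h1 := Rlt_le_trans _ _ _ hx (Rmin_l _ _)).
assert (h2 := Rlt_le_trans _ _ _ hx (Rmin_r _ _)).
rewrite phi_eq by lra.
assert (hs := sinc_bounds x ltac:(lra)); assert (hc := c_pos).
assert (hp := tpow_pos q x).
assert (hp1 : tpow q x <= tpow 1 x).
{ destruct hq as [hq | <-]; [left; apply tpow_decreasing; lra | lra]. }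
assert (e : tpow 1 x = 2 / PI * x).
{ unfold tpow; rewrite Rmult_1_l, exp_ln; [field; lra | apply Rdiv_lt_0_compat; lra]. }
rewrite e in hp1.
apply Rabs_lt_between; split; nra.
Qed.

(** Since 1 - sin x / x <= x^2/2 <= 2 t^2, it suffices that c t^q > 2 t^2. The
    choice t^(2-q) = c/4 achieves this. *)
Lemma phi_pos_somewhere q : q < 2 -> exists p, 0 < p < PI / 2 /\ 0 < phi q p.
Proof.
intros hq; assert (hPI := PI_gt_3); assert (hc := c_pos); assert (h4 := PI_4).
set (s := ln ((1 - 2 / PI) / 4) / (2 - q)).
assert (hs : s < 0).
{ apply Rdiv_neg_pos; [| lra].
  rewrite <- ln_1; apply ln_increasing; lra. }
assert (he : 0 < exp s < 1).
{ split; [apply exp_pos | rewrite <- exp_0; now apply exp_increasing]. }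
exists (PI / 2 * exp s); split; [nra |].
rewrite phi_eq by nra.
assert (ht : 2 * (PI / 2 * exp s) / PI = exp s) by (field; lra).
assert (hsc := sinc_bounds (PI / 2 * exp s) ltac:(nra)).
assert (hp : tpow q (PI / 2 * exp s) * ((1 - 2 / PI) / 4) = exp s * exp s).
{ unfold tpow; rewrite ht, ln_exp.
  rewrite <- (exp_ln ((1 - 2 / PI) / 4)) by lra.
  replace (ln ((1 - 2 / PI) / 4)) with ((2 - q) * s) by (unfold s; field; lra).
  rewrite <- !exp_plus; f_equal; ring. }
assert (0 < exp s * exp s) by nra.
assert (PI / 2 * (PI / 2) <= 4) by nra.
nra.
Qed.

(** * The sign of the derivative *)

Definition gap (x : R) : R := sin x / x - cos x.

(** This is x times the derivative of [phi q] at x. *)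
Definition slope (q x : R) : R := q * (1 - 2 / PI) * tpow q x - gap x.

(** The slope vanishes where this function takes the value q (1 - 2/PI), and is
    positive where it lies below. *)
Definition level (q x : R) : R := gap x * tpow (- q) x.

(** The derivative of [level q] has the sign of [ratio - (1 + q)]. *)
Definition ratio (x : R) : R := x * sin x / gap x.

Lemma is_derive_tpow q x : 0 < x -> is_derive (tpow q) x (q * tpow q x / x).
Proof.
intros hx; assert (h := PI_gt_3); unfold tpow; auto_derive.
- repeat split; auto; apply Rdiv_lt_0_compat; lra.
- unfold Rdiv; field; lra.
Qed.

Lemma is_derive_phi q x : 0 < x -> is_derive (phi q) x (slope q x / x).
Proof.
intros hx; assert (h := PI_gt_3).
apply is_derive_ext_loc with (fun x => (1 - 2 / PI) * tpow q x - (1 - sin x / x)).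
- exists (mkposreal x hx); intros y hy; symmetry; apply phi_eq.
  apply Rabs_lt_between' in hy; simpl in hy; lra.
- assert (hd := is_derive_tpow q x hx).
  auto_derive.
  + repeat split; auto; [now exists (q * tpow q x / x) | lra].
  + replace (Derive (fun x0 => tpow q x0) x) with (q * tpow q x / x)
      by (symmetry; now apply is_derive_unique).
    unfold slope, gap; field; lra.
Qed.

Lemma is_derive_level q x :
  0 < x -> is_derive (level q) x ((x * sin x - (1 + q) * gap x) * tpow (- q) x / x).
Proof.
intros hx; assert (hd := is_derive_tpow (- q) x hx); unfold level, gap.
auto_derive.
- repeat split; auto; [lra | now exists (- q * tpow (- q) x / x)].
- replace (Derive (fun x0 => tpow (- q) x0) x) with (- q * tpow (- q) x / x)
    by (symmetry; now apply is_derive_unique).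
  field; lra.
Qed.

Lemma slope_level q x : slope q x = tpow q x * (q * (1 - 2 / PI) - level q x).
Proof.
unfold slope, level; assert (h := tpow_opp q x).
replace (gap x) with (gap x * (tpow q x * tpow (- q) x)) at 1 by (rewrite h; ring).
ring.
Qed.

Lemma slope_pos q x : level q x < q * (1 - 2 / PI) <-> 0 < slope q x.
Proof.
rewrite slope_level; assert (h := tpow_pos q x); split; intros h1; nra.
Qed.

Lemma slope_neg q x : q * (1 - 2 / PI) < level q x <-> slope q x < 0.
Proof.
rewrite slope_level; assert (h := tpow_pos q x); split; intros h1; nra.
Qed.

Lemma slope_zero q x : slope q x = 0 -> level q x = q * (1 - 2 / PI).
Proof.
rewrite slope_level; assert (h := tpow_pos q x); intros h1; nra.
Qed.

Lemma slope_end q : slope q (PI / 2) = q * (1 - 2 / PI) - 2 / PI.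
Proof.
assert (hPI := PI_gt_3).
unfold slope, gap; rewrite tpow_at_end, sin_PI2, cos_PI2; field; lra.
Qed.

Lemma q1_times_c : q1 * (1 - 2 / PI) = 2 / PI.
Proof. assert (hPI := PI_gt_3); unfold q1; field; lra. Qed.

Lemma phi_increasing_on q a b :
  0 < a -> a < b -> (forall x, a < x < b -> 0 < slope q x) -> phi q a < phi q b.
Proof.
intros ha hab hs; apply (lt_of_derive_pos (phi q) (fun x => slope q x / x)); auto.
- intros x hx; apply is_derive_phi; lra.
- intros x hx; apply Rdiv_lt_0_compat; [auto | lra].
Qed.

Lemma phi_decreasing_on q a b :
  0 < a -> a < b -> (forall x, a < x < b -> slope q x < 0) -> phi q b < phi q a.
Proof.
intros ha hab hs; apply (gt_of_derive_neg (phi q) (fun x => slope q x / x)); auto.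
- intros x hx; apply is_derive_phi; lra.
- intros x hx; apply Rdiv_neg_pos; [auto | lra].
Qed.

Lemma gap_pos x : 0 < x < PI -> 0 < gap x.
Proof.
intros hx; assert (h := sin_gt_x_cos x hx); unfold gap.
replace (sin x / x - cos x) with ((sin x - x * cos x) / x) by (field; lra).
apply Rdiv_lt_0_compat; lra.
Qed.

(** The numerator of the derivative is the negative of the difference in
    [wilker_type]. *)
Lemma ratio_decreasing x y :
  0 < x -> x < y -> y < PI / 2 -> ratio y < ratio x.
Proof.
intros hx hxy hy.
apply (gt_of_derive_neg ratio (fun x =>
  - ((x * x + x * (sin x * cos x) - 2 * (sin x * sin x))
     / (x * (gap x * gap x))))); [lra | |].
- intros z hz; assert (hg := gap_pos z ltac:(lra)).
  assert (hsn : 0 < sin z - z * cos z)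
    by (generalize (sin_gt_x_cos z ltac:(lra)); lra).
  assert (h := sin2_cos2 z); unfold Rsqr in h.
  replace (z * z + _ - _) with
    (z * z * (sin z * sin z + cos z * cos z) + z * (sin z * cos z) - 2 * (sin z * sin z))
    by (rewrite h; ring).
  unfold ratio, gap in *; auto_derive.
  + repeat split; auto; [lra |]; unfold Rminus, Rdiv in hg; lra.
  + field; lra.
- intros z hz; assert (hg := gap_pos z ltac:(lra)).
  assert (hw := wilker_type z ltac:(lra)).
  apply Ropp_lt_gt_0_contravar, Rdiv_lt_0_compat; [lra |].
  repeat apply Rmult_lt_0_compat; lra.
Qed.

Lemma ratio_lt_3 x : 0 < x < PI / 2 -> x * sin x < 3 * gap x.
Proof.
intros hx.
set (f := fun x => x * x * sin x - 3 * (sin x - x * cos x)).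
assert (h : f x < f 0).
{ apply (gt_of_derive_neg f (fun x => x * (x * cos x - sin x))); [lra | |].
  - intros y _; unfold f; auto_derive; [auto | ring].
  - intros y hy; assert (h := sin_gt_x_cos y ltac:(lra)); nra. }
unfold f in h; rewrite sin_0 in h; unfold gap.
apply Rmult_lt_reg_l with x; [lra |].
replace (x * (3 * (sin x / x - cos x))) with (3 * (sin x - x * cos x)) by (field; lra).
lra.
Qed.

Lemma level_increasing_on q a b :
  0 < a -> a < b -> b <= PI / 2 ->
  (forall x, a < x < b -> 1 + q < ratio x) -> level q a < level q b.
Proof.
intros ha hab hb hs; assert (h := PI_gt_3).
apply (lt_of_derive_pos (level q)
  (fun x => (x * sin x - (1 + q) * gap x) * tpow (- q) x / x)); auto.
- intros x hx; apply is_derive_level; lra.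
- intros x hx; apply Rdiv_lt_0_compat; [| lra].
  apply Rmult_lt_0_compat; [| apply tpow_pos].
  specialize (hs x hx); apply Rlt_div_r in hs; [lra |].
  apply gap_pos; lra.
Qed.

Lemma level_decreasing_on q a b :
  0 < a -> a < b -> b <= PI / 2 ->
  (forall x, a < x < b -> ratio x < 1 + q) -> level q b < level q a.
Proof.
intros ha hab hb hs; assert (h := PI_gt_3).
apply (gt_of_derive_neg (level q)
  (fun x => (x * sin x - (1 + q) * gap x) * tpow (- q) x / x)); auto.
- intros x hx; apply is_derive_level; lra.
- intros x hx; apply Rdiv_neg_pos; [| lra].
  assert (hp := tpow_pos (- q) x).
  specialize (hs x hx); apply Rlt_div_l in hs; [nra |].
  apply gap_pos; lra.
Qed.

(** * The shape of the error function *)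

(** Up to [m1], down to [m2], up again. The case m2 = PI/2 is allowed: it
    describes [phi q1], which does not rise again. *)
Definition shape (q m1 m2 : R) : Prop :=
  (0 < m1 /\ m1 < m2 /\ m2 <= PI / 2) /\ (slope q m1 = 0 /\ slope q m2 = 0) /\
  (forall x, 0 < x < m1 -> 0 < slope q x) /\
  (forall x, m1 < x < m2 -> slope q x < 0) /\
  (forall x, m2 < x < PI / 2 -> 0 < slope q x).

(** The level function is equal at the two critical points, so by Rolle its
    derivative vanishes at some xi between them. As [ratio] decreases, the level
    function rises before xi and falls after it, hence exceeds its common value
    exactly between the two critical points. *)
Lemma shape_of_critical q m1 m2 :
  0 < m1 -> m1 < m2 -> m2 <= PI / 2 -> slope q m1 = 0 -> slope q m2 = 0 ->
  shape q m1 m2.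
Proof.
intros h0 h12 h2 e1 e2; assert (hPI := PI_gt_3).
assert (l1 := slope_zero q m1 e1); assert (l2 := slope_zero q m2 e2).
destruct (rolle (level q) (fun x => (x * sin x - (1 + q) * gap x) * tpow (- q) x / x)
  m1 m2 h12) as [xi [hxi hz]].
{ congruence. }
{ intros x hx; apply is_derive_level; lra. }
assert (hr : ratio xi = 1 + q).
{ assert (hg := gap_pos xi ltac:(lra)); assert (hp := tpow_pos (- q) xi).
  unfold ratio; apply Rmult_eq_reg_r with (gap xi); [| lra].
  unfold Rdiv in *; rewrite Rmult_assoc, Rinv_l, Rmult_1_r by lra.
  apply Rmult_integral in hz; destruct hz as [hz | hz].
  - nra.
  - assert (hi := Rinv_0_lt_compat xi ltac:(lra)); lra. }
assert (hin : forall a b, 0 < a -> a < b -> b <= xi -> level q a < level q b).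
{ intros a b ha hab hb; apply level_increasing_on; try lra.
  intros x hx; rewrite <- hr; apply ratio_decreasing; lra. }
assert (hde : forall a b, xi <= a -> a < b -> b <= PI / 2 -> level q b < level q a).
{ intros a b ha hab hb; apply level_decreasing_on; try lra.
  intros x hx; rewrite <- hr; apply ratio_decreasing; lra. }
split; [lra |]; split; [lra |]; split; [| split]; intros x hx.
- apply slope_pos; rewrite <- l1; apply hin; lra.
- apply slope_neg; destruct (Rle_lt_dec x xi).
  + rewrite <- l1; apply hin; lra.
  + rewrite <- l2; apply hde; lra.
- apply slope_pos; rewrite <- l2; apply hde; lra.
Qed.

Lemma shape_rises_first q m1 m2 :
  shape q m1 m2 -> forall x y, 0 < x -> x < y -> y <= m1 -> phi q x < phi q y.
Proof.
intros (h1 & h2 & h3 & h4 & h5) x y hx hxy hy.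
apply phi_increasing_on; auto; intros z hz; apply h3; lra.
Qed.

Lemma shape_falls q m1 m2 :
  shape q m1 m2 -> forall x y, m1 <= x -> x < y -> y <= m2 -> phi q y < phi q x.
Proof.
intros (h1 & h2 & h3 & h4 & h5) x y hx hxy hy.
apply phi_decreasing_on; try lra; intros z hz; apply h4; lra.
Qed.

Lemma shape_rises_last q m1 m2 :
  shape q m1 m2 -> forall x y, m2 <= x -> x < y -> y <= PI / 2 -> phi q x < phi q y.
Proof.
intros (h1 & h2 & h3 & h4 & h5) x y hx hxy hy.
apply phi_increasing_on; try lra; intros z hz; apply h5; lra.
Qed.

Lemma shape_pos q m1 m2 :
  1 <= q -> shape q m1 m2 -> forall x, 0 < x <= m1 -> 0 < phi q x.
Proof.
intros hq hs; apply pos_of_increasing_from_0; [now apply phi_vanishes_at_0 |].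
exact (shape_rises_first q m1 m2 hs).
Qed.

Lemma shape_neg q m1 m2 :
  shape q m1 m2 -> forall x, m2 <= x < PI / 2 -> phi q x < 0.
Proof.
intros hs x hx; rewrite <- (phi_end q); apply shape_rises_last with m1 m2; auto; lra.
Qed.

Lemma shape_max q m1 m2 :
  1 <= q -> shape q m1 m2 -> forall x, 0 < x < PI / 2 -> phi q x <= phi q m1.
Proof.
intros hq hs x hx; assert (hs' := hs); destruct hs' as (h1 & _).
assert (hp := shape_pos q m1 m2 hq hs m1 ltac:(lra)).
destruct (Rtotal_order x m1) as [h | [-> | h]]; [| lra |].
- left; apply shape_rises_first with m1 m2; auto; lra.
- destruct (Rle_lt_dec x m2).
  + left; apply shape_falls with m1 m2; auto; lra.
  + assert (hn := shape_neg q m1 m2 hs x ltac:(lra)); lra.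
Qed.

Lemma shape_min q m1 m2 :
  1 <= q -> shape q m1 m2 -> m2 < PI / 2 ->
  forall x, 0 < x < PI / 2 -> phi q m2 <= phi q x.
Proof.
intros hq hs h2 x hx; assert (hs' := hs); destruct hs' as (h1 & _).
assert (hn := shape_neg q m1 m2 hs m2 ltac:(lra)).
destruct (Rlt_le_dec x m1) as [hl | hl].
- assert (hp := shape_pos q m1 m2 hq hs x ltac:(lra)); lra.
- destruct (Rtotal_order x m2) as [h | [-> | h]]; [| lra |]; left.
  + apply shape_falls with m1 m2; auto; lra.
  + apply shape_rises_last with m1 m2; auto; lra.
Qed.

(** Only the middle interval has negative slope, and [l] precedes a point of it. *)
Lemma shape_localize_max q m1 m2 l r :
  shape q m1 m2 -> 0 < l -> l < r -> r < PI / 2 ->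
  0 < slope q l -> slope q r < 0 -> l < m1 < r.
Proof.
intros (h1 & h2 & h3 & h4 & h5) hl hlr hr sl sr.
assert (a1 : m1 < r).
{ apply Rnot_le_lt; intros [h | h]; [specialize (h3 r ltac:(lra)); lra | rewrite h in sr; lra]. }
assert (a2 : r < m2).
{ apply Rnot_le_lt; intros [h | h]; [specialize (h5 r ltac:(lra)); lra | rewrite h in h2; lra]. }
split; [| lra].
apply Rnot_le_lt; intros [h | h]; [specialize (h4 l ltac:(lra)); lra | rewrite h in h2; lra].
Qed.

Lemma shape_localize_min q m1 m2 l r :
  shape q m1 m2 -> 0 < l -> l < r -> r < PI / 2 ->
  slope q l < 0 -> 0 < slope q r -> l < m2 < r.
Proof.
intros (h1 & h2 & h3 & h4 & h5) hl hlr hr sl sr.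
assert (a1 : m1 < l).
{ apply Rnot_le_lt; intros [h | h]; [specialize (h3 l ltac:(lra)); lra | rewrite h in sl; lra]. }
split.
- apply Rnot_le_lt; intros [h | h]; [specialize (h5 l ltac:(lra)); lra | rewrite h in h2; lra].
- apply Rnot_le_lt; intros [h | h]; [specialize (h4 r ltac:(lra)); lra | rewrite h in sr; lra].
Qed.

(** * Rational enclosures of exp, sin, cos and PI *)

(** Taylor sums in Horner form: [horner_sum rho k n] is the sum of the first n + 1
    terms of a series, starting at index k and divided by its k-th term, when
    [rho j] is the quotient of the terms of indices j + 1 and j. *)
Fixpoint horner_sum (rho : nat -> Q) (k n : nat) : Q :=
  match n with
  | O => 1
  | S n => 1 + rho k * horner_sum rho (S k) n
  end%Q.

Lemma horner_sum_spec (a : nat -> R) (rho : nat -> Q) :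
  (forall k, a (S k) = a k * Q2R (rho k)) ->
  forall n k, a k * Q2R (horner_sum rho k n) = sum_f_R0 (fun j => a (j + k)%nat) n.
Proof.
intros ha; induction n as [| n IH]; intros k.
- simpl; unfold Q2R; simpl; field.
- rewrite decomp_sum by lia; simpl.
  rewrite Q2R_plus, Q2R_mult; replace (Q2R 1) with 1 by (unfold Q2R; simpl; field).
  rewrite Rmult_plus_distr_l, Rmult_1_r, <- Rmult_assoc, <- ha, IH.
  f_equal; apply sum_eq; intros i _; f_equal; lia.
Qed.

Definition qnat (n : nat) : Q := inject_Z (Z.of_nat n).

Lemma Q2R_qnat n : Q2R (qnat n) = INR n.
Proof. unfold Q2R, qnat; simpl; rewrite INR_IZR_INZ; field. Qed.

Lemma qnat_S_neq0 n : ~ (qnat (S n) == 0)%Q.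
Proof. intros h; apply Qeq_eqR in h; rewrite Q2R_qnat, RMicromega.Q2R_0 in h; now apply not_0_INR in h. Qed.

Lemma Q2R_IZR z : Q2R (z # 1) = IZR z.
Proof. unfold Q2R; simpl; field. Qed.

Lemma Q2R_frac (n : Z) (d : positive) : Q2R (n # d) = IZR n / IZR (Zpos d).
Proof. reflexivity. Qed.

Definition Qlt_bool (x y : Q) : bool := negb (Qle_bool y x).

Lemma Q2R_le_check (x y : Q) : Qle_bool x y = true -> Q2R x <= Q2R y.
Proof. intros h; now apply Qle_Rle, Qle_bool_iff. Qed.

Lemma Q2R_lt_check (x y : Q) : Qlt_bool x y = true -> Q2R x < Q2R y.
Proof.
unfold Qlt_bool; intros h; apply Qlt_Rlt, Qnot_le_lt; intros h1.
apply Qle_bool_iff in h1; rewrite h1 in h; discriminate.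
Qed.

(** Quotients of consecutive terms in the series of exp(-y). *)
Definition exp_terms (y : Q) : nat -> Q := fun k => (- y / qnat (S k))%Q.

Definition exp_poly (y : Q) (n : nat) : Q := horner_sum (exp_terms y) 0 n.

Definition exp_sum (n : nat) (y : R) : R := sum_f_R0 (fun k => (- y) ^ k / INR (fact k)) n.

Lemma exp_poly_sum y n : Q2R (exp_poly y n) = exp_sum n (Q2R y).
Proof.
assert (h := horner_sum_spec (fun k => (- Q2R y) ^ k / INR (fact k)) (exp_terms y)).
unfold exp_poly, exp_sum; rewrite <- (Rmult_1_l (Q2R _)).
replace 1 with ((- Q2R y) ^ 0 / INR (fact 0)) by (simpl; field).
rewrite h.
- apply sum_eq; intros i _; now rewrite Nat.add_0_r.
- intros k; unfold exp_terms.
  rewrite Q2R_div, Q2R_opp, Q2R_qnat by apply qnat_S_neq0.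
  rewrite fact_simpl, mult_INR; simpl pow; field; split; try apply INR_fact_neq_0; now apply not_0_INR.
Qed.

Lemma is_derive_exp_sum n y : is_derive (exp_sum (S n)) y (- exp_sum n y).
Proof.
induction n as [| n IH].
- unfold exp_sum; simpl; auto_derive; [auto | field].
- apply is_derive_ext with
    (fun y => exp_sum (S n) y + (- y) ^ S (S n) / INR (fact (S (S n)))).
  { intros t; unfold exp_sum; symmetry; apply tech5. }
  replace (- exp_sum (S n) y) with (plus (- exp_sum n y) (- ((- y) ^ S n / INR (fact (S n))))).
  2: { unfold plus; simpl plus; unfold exp_sum; rewrite tech5; simpl; ring. }
  apply (is_derive_plus (exp_sum (S n)) (fun y => (- y) ^ S (S n) / INR (fact (S (S n))))); [exact IH |].
  replace (- ((- y) ^ S n / INR (fact (S n))))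
    with (- (INR (S (S n)) * (- y) ^ S n / INR (fact (S (S n))))).
  2: { rewrite (fact_simpl (S n)), mult_INR.
       field; split; try apply INR_fact_neq_0; now apply not_0_INR. }
  generalize (INR_fact_neq_0 (S (S n))) (INR (fact (S (S n)))) (S n).
  clear; intros _ F k; auto_derive; [auto | simpl INR; unfold Rdiv; ring].
Qed.

Lemma exp_sum_0 n : exp_sum n 0 = 1.
Proof.
unfold exp_sum; induction n as [| n IH]; [simpl; field |].
rewrite tech5, IH, Ropp_0, pow_i by lia; field; apply INR_fact_neq_0.
Qed.

(** Each Taylor sum of exp(-y) has the opposite of the previous one as derivative,
    just as exp(-y) itself, so an upper bound integrates to a lower bound and
    conversely. In this way y need not be so small that the terms decrease. *)
Lemma exp_sum_alternates n y :
  0 <= y ->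
  exp_sum (S (2 * n)) y <= exp (- y) <= exp_sum (2 * n) y.
Proof.
intros hy.
assert (step : forall m y, 0 <= y ->
  (forall z, 0 <= z <= y -> exp (- z) <= exp_sum m z) ->
  exp_sum (S m) y <= exp (- y)).
{ intros m z hz h.
  enough (exp (- 0) - exp_sum (S m) 0 <= exp (- z) - exp_sum (S m) z)
    by (rewrite exp_sum_0, Ropp_0, exp_0 in *; lra).
  apply (le_of_derive_nonneg (fun z => exp (- z) - exp_sum (S m) z)
    (fun z => exp_sum m z - exp (- z))); auto.
  - intros x _.
    replace (exp_sum m x - exp (- x)) with (minus (- exp (- x)) (- exp_sum m x))
      by (unfold minus, plus, opp; simpl; ring).
    apply (is_derive_minus (fun z => exp (- z)) (exp_sum (S m)));
      [auto_derive; [auto | ring] | apply is_derive_exp_sum].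
  - intros x hx; specialize (h x hx); lra. }
assert (step' : forall m y, 0 <= y ->
  (forall z, 0 <= z <= y -> exp_sum m z <= exp (- z)) ->
  exp (- y) <= exp_sum (S m) y).
{ intros m z hz h.
  enough (exp_sum (S m) 0 - exp (- 0) <= exp_sum (S m) z - exp (- z))
    by (rewrite exp_sum_0, Ropp_0, exp_0 in *; lra).
  apply (le_of_derive_nonneg (fun z => exp_sum (S m) z - exp (- z))
    (fun z => exp (- z) - exp_sum m z)); auto.
  - intros x _.
    replace (exp (- x) - exp_sum m x) with (minus (- exp_sum m x) (- exp (- x)))
      by (unfold minus, plus, opp; simpl; ring).
    apply (is_derive_minus (exp_sum (S m)) (fun z => exp (- z)));
      [apply is_derive_exp_sum | auto_derive; [auto | ring]].
  - intros x hx; specialize (h x hx); lra. }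
assert (all : forall n y, 0 <= y -> exp (- y) <= exp_sum (2 * n) y).
{ induction n0 as [| k IH]; intros z hz.
  - replace (exp_sum (2 * 0) z) with (exp 0) by (rewrite exp_0; unfold exp_sum; simpl; field).
    destruct hz as [hz | <-]; [left; apply exp_increasing; lra | rewrite Ropp_0; lra].
  - replace (2 * S k)%nat with (S (S (2 * k))) by lia.
    apply step'; auto; intros x hx.
    apply step; [lra |]; intros x' hx'; apply IH; lra. }
split; [| now apply all].
apply step; auto; intros z hz; apply all; lra.
Qed.

(** Degree 30 leaves an error below 10^(-16) for the arguments used, which stay
    below 3.4. *)
Definition exp_lo (y : Q) : Q := exp_poly y 31.

Definition exp_hi (y : Q) : Q := exp_poly y 30.

Lemma exp_bounds y :
  (0 <= y)%Q -> Q2R (exp_lo y) <= exp (- Q2R y) <= Q2R (exp_hi y).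
Proof.
intros hy; unfold exp_lo, exp_hi; rewrite !exp_poly_sum.
apply (exp_sum_alternates 15); apply Qle_Rle in hy.
now rewrite RMicromega.Q2R_0 in hy.
Qed.

Definition sin_terms (x : Q) : nat -> Q :=
  fun k => (- (x * x) / (qnat (S (S (2 * k))) * qnat (S (S (S (2 * k))))))%Q.

Definition cos_terms (x : Q) : nat -> Q :=
  fun k => (- (x * x) / (qnat (S (2 * k)) * qnat (S (S (2 * k)))))%Q.

Definition sin_poly (x : Q) (n : nat) : Q := (x * horner_sum (sin_terms x) 0 n)%Q.

Definition cos_poly (x : Q) (n : nat) : Q := horner_sum (cos_terms x) 0 n.

Lemma sin_poly_sum x n : Q2R (sin_poly x n) = sin_approx (Q2R x) n.
Proof.
unfold sin_poly, sin_approx; rewrite Q2R_mult.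
assert (h := horner_sum_spec (sin_term (Q2R x)) (sin_terms x)).
replace (Q2R x) with (sin_term (Q2R x) 0) at 1 by (unfold sin_term; simpl; field).
rewrite h.
- apply sum_eq; intros i _; now rewrite Nat.add_0_r.
- intros k; unfold sin_terms, sin_term.
  rewrite Q2R_div, Q2R_opp, !Q2R_mult, !Q2R_qnat
    by (intros e; apply Qmult_integral in e; destruct e as [e | e]; now apply qnat_S_neq0 in e).
  replace (2 * S k + 1)%nat with (S (S (2 * k + 1))) by lia.
  rewrite !fact_simpl, !mult_INR.
  replace (S (S (S (2 * k)))) with (S (S (2 * k + 1))) by lia.
  replace (S (S (2 * k))) with (S (2 * k + 1)) by lia.
  simpl pow; field; repeat split; try apply INR_fact_neq_0; now apply not_0_INR.
Qed.

Lemma cos_poly_sum x n : Q2R (cos_poly x n) = cos_approx (Q2R x) n.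
Proof.
unfold cos_poly, cos_approx.
assert (h := horner_sum_spec (cos_term (Q2R x)) (cos_terms x)).
rewrite <- (Rmult_1_l (Q2R _)).
replace 1 with (cos_term (Q2R x) 0) by (unfold cos_term; simpl; field).
rewrite h.
- apply sum_eq; intros i _; now rewrite Nat.add_0_r.
- intros k; unfold cos_terms, cos_term.
  rewrite Q2R_div, Q2R_opp, !Q2R_mult, !Q2R_qnat
    by (intros e; apply Qmult_integral in e; destruct e as [e | e]; now apply qnat_S_neq0 in e).
  replace (2 * S k)%nat with (S (S (2 * k))) by lia.
  rewrite !fact_simpl, !mult_INR.
  simpl pow; field; repeat split; try apply INR_fact_neq_0; now apply not_0_INR.
Qed.

Definition sin_lo (x : Q) : Q := sin_poly x 11.

Definition sin_hi (x : Q) : Q := sin_poly x 12.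

Definition cos_lo (x : Q) : Q := cos_poly x 11.

Definition cos_hi (x : Q) : Q := cos_poly x 12.

Lemma sin_poly_bounds n x :
  0 <= Q2R x <= 4 ->
  Q2R (sin_poly x (2 * n + 1)) <= sin (Q2R x) <= Q2R (sin_poly x (2 * (n + 1))).
Proof. intros hx; rewrite !sin_poly_sum; apply pre_sin_bound; lra. Qed.

Lemma sin_bounds x :
  0 <= Q2R x <= 4 -> Q2R (sin_lo x) <= sin (Q2R x) <= Q2R (sin_hi x).
Proof. exact (sin_poly_bounds 5 x). Qed.

Lemma cos_bounds x :
  0 <= Q2R x <= 2 -> Q2R (cos_lo x) <= cos (Q2R x) <= Q2R (cos_hi x).
Proof.
intros hx; unfold cos_lo, cos_hi; rewrite !cos_poly_sum.
apply (pre_cos_bound (Q2R x) 5); lra.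
Qed.

Definition pi_lo : Q := 31415926535897932 # 10000000000000000.

Definition pi_hi : Q := 31415926535897933 # 10000000000000000.

(** PI is the only sign change of sin on (0, 4], so the signs of the Taylor bounds
    at the two rationals decide. *)
Lemma PI_bounds : Q2R pi_lo < PI < Q2R pi_hi.
Proof.
assert (h := PI2_3_2).
assert (hl : 0 <= Q2R pi_lo <= 4 /\ 0 <= Q2R pi_hi <= 4) by (unfold Q2R; simpl; lra).
split.
- apply Rnot_le_lt; intros hn.
  assert (h1 := proj1 (sin_poly_bounds 9 pi_lo ltac:(lra))).
  assert (h2 : sin (Q2R pi_lo) <= 0) by (apply sin_le_0; lra).
  assert (h3 := Q2R_lt_check 0 (sin_poly pi_lo 19) ltac:(vm_compute; reflexivity)).
  rewrite RMicromega.Q2R_0 in h3; simpl Nat.mul in *; simpl Nat.add in *; lra.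
- apply Rnot_le_lt; intros hn.
  assert (h1 := proj2 (sin_poly_bounds 9 pi_hi ltac:(lra))).
  assert (h2 : 0 <= sin (Q2R pi_hi)) by (apply sin_ge_0; lra).
  assert (h3 := Q2R_lt_check (sin_poly pi_hi 20) 0 ltac:(vm_compute; reflexivity)).
  rewrite RMicromega.Q2R_0 in h3; simpl Nat.mul in *; simpl Nat.add in *; lra.
Qed.

Lemma PI_approx : 3.141592653589 < PI < 3.14159265359.
Proof.
assert (h := PI_bounds); unfold Q2R in h; simpl in h; lra.
Qed.

Lemma q1_bounds : 1.75193 <= q1 < 1.75194.
Proof.
assert (h := PI_approx); unfold q1; split.
- apply -> Rle_div_r; lra.
- apply Rlt_div_l; lra.
Qed.

(** * Critical points and the inequalities *)

Lemma phi_continuous q x : 0 < x -> continuity_pt (phi q) x.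
Proof.
intros hx; apply derivable_continuous_pt; exists (slope q x / x).
now apply is_derive_Reals, is_derive_phi.
Qed.

Lemma slope_eq_0 q x : 0 < x -> slope q x / x = 0 -> slope q x = 0.
Proof.
intros hx h; apply Rmult_integral in h; destruct h as [h | h]; auto.
assert (h' := Rinv_0_lt_compat x hx); lra.
Qed.

Lemma phi_changes_sign q :
  q1 < q < 2 -> exists x0, 0 < x0 < PI / 2 /\ phi q x0 = 0.
Proof.
intros hq; assert (hPI := PI_gt_3); assert (hc := c_pos); assert (h1 := q1_times_c).
destruct (phi_pos_somewhere q ltac:(lra)) as [p [hp hpp]].
destruct (neg_left_of_zero (phi q) (slope q (PI / 2) / (PI / 2)) p (PI / 2))
  as [p' [hp' hpn]].
- lra.
- apply phi_end.
- apply is_derive_phi; lra.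
- apply Rdiv_lt_0_compat; [rewrite slope_end; nra | lra].
- destruct (IVT_interv (fun x => - phi q x) p p') as [x0 [hx0 hz]]; try lra.
  { intros a ha; apply continuity_pt_opp, phi_continuous; lra. }
  exists x0; split; lra.
Qed.

Lemma shape_between q :
  q1 < q < 2 ->
  exists m1 m2 x0, shape q m1 m2 /\ m1 < x0 < m2 /\ m2 < PI / 2 /\ phi q x0 = 0.
Proof.
intros hq; assert (hPI := PI_gt_3); assert (hb := q1_bounds).
destruct (phi_changes_sign q hq) as [x0 [hx0 hz]].
destruct (rolle_from_0 (phi q) (fun x => slope q x / x) x0) as [m1 [hm1 e1]]; try lra.
{ apply phi_vanishes_at_0; lra. }
{ intros x hx; apply is_derive_phi; lra. }
destruct (rolle (phi q) (fun x => slope q x / x) x0 (PI / 2)) as [m2 [hm2 e2]]; try lra.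
{ rewrite phi_end; lra. }
{ intros x hx; apply is_derive_phi; lra. }
exists m1, m2, x0; split; [| lra].
apply shape_of_critical; try lra; apply slope_eq_0; lra.
Qed.

Lemma shape_q1 : exists m, m < PI / 2 /\ shape q1 m (PI / 2).
Proof.
assert (hPI := PI_gt_3); assert (hb := q1_bounds).
destruct (rolle_from_0 (phi q1) (fun x => slope q1 x / x) (PI / 2)) as [m [hm e]]; try lra.
{ apply phi_end. }
{ apply phi_vanishes_at_0; lra. }
{ intros x hx; apply is_derive_phi; lra. }
exists m; split; [lra |]; apply shape_of_critical; try lra.
- apply slope_eq_0; lra.
- rewrite slope_end, q1_times_c; lra.
Qed.

Lemma shape_q2 :
  exists m, 0 < m < PI / 2 /\ (forall x, 0 < x < m -> slope 2 x < 0) /\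
    (forall x, m < x < PI / 2 -> 0 < slope 2 x).
Proof.
assert (hPI := PI_gt_3).
destruct (rolle_from_0 (phi 2) (fun x => slope 2 x / x) (PI / 2)) as [m [hm e]]; try lra.
{ apply phi_end. }
{ apply phi_vanishes_at_0; lra. }
{ intros x hx; apply is_derive_phi; lra. }
apply slope_eq_0 in e; [| lra].
assert (l := slope_zero 2 m e).
assert (hde : forall a b, 0 < a -> a < b -> b < PI / 2 -> level 2 b < level 2 a).
{ intros a b ha hab hb; apply level_decreasing_on; try lra.
  intros x hx; apply Rlt_div_l; [apply gap_pos; lra |].
  assert (h := ratio_lt_3 x ltac:(lra)); lra. }
exists m; split; [lra |]; split; intros x hx.
- apply slope_neg; rewrite <- l; apply hde; lra.
- apply slope_pos; rewrite <- l; apply hde; lra.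
Qed.

Lemma phi_q1_pos x : 0 < x < PI / 2 -> 0 < phi q1 x.
Proof.
intros hx; destruct shape_q1 as [m [hm hs]]; assert (hb := q1_bounds).
destruct (Rle_lt_dec x m).
- apply shape_pos with m (PI / 2); auto; lra.
- rewrite <- (phi_end q1); apply shape_falls with m (PI / 2); auto; lra.
Qed.

Lemma phi_q2_neg x : 0 < x < PI / 2 -> phi 2 x < 0.
Proof.
intros hx; destruct shape_q2 as [m (h1 & h3 & h4)].
destruct (Rlt_le_dec x m).
- enough (0 < - phi 2 x) by lra.
  apply (pos_of_increasing_from_0 (fun x => - phi 2 x) m); [| | lra].
  + intros eps he; destruct (phi_vanishes_at_0 2 ltac:(lra) eps he) as [d [hd h]].
    exists d; split; auto; intros y hy; rewrite Rabs_Ropp; auto.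
  + intros a b ha hab hb; apply Ropp_lt_contravar, phi_decreasing_on; auto.
    intros z hz; apply h3; lra.
- rewrite <- (phi_end 2); apply phi_increasing_on; try lra.
  intros z hz; apply h4; lra.
Qed.

(** For q > q1 the inequality already fails at the minimum point of some [phi q']
    with q' in (q1, 2) and q' <= q. *)
Lemma inequality_upto_q1 :
  (forall q, 0 < q <= q1 -> forall x, 0 < x < PI / 2 ->
      sin x / x > approx q1 x /\ approx q1 x >= approx q x) /\
   is_largest
     (fun q => forall x, 0 < x < PI / 2 -> sin x / x > approx q x) q1.
Proof.
assert (hb := q1_bounds).
assert (hpos : forall x, 0 < x < PI / 2 -> sin x / x > approx q1 x).
{ intros x hx; assert (h := phi_q1_pos x hx); rewrite phi_approx in h; lra. }
split; [| split; [exact hpos |]].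
- intros q hq x hx; split; [auto |].
  assert (h := phi_nonincreasing q q1 x hx ltac:(lra)); rewrite !phi_approx in h; lra.
- intros q hq; apply Rnot_lt_le; intros hlt.
  set (q' := Rmin q ((q1 + 2) / 2)).
  assert (hq' : q1 < q' /\ q' <= q /\ q' <= (q1 + 2) / 2).
  { unfold q'; repeat split; [apply Rmin_glb_lt; lra | apply Rmin_l | apply Rmin_r]. }
  destruct (shape_between q' ltac:(lra)) as (m1 & m2 & x0 & hs & hx0 & hm2 & _).
  assert (h0 : 0 < m1) by apply hs.
  assert (hn := shape_neg q' m1 m2 hs m2 ltac:(lra)).
  specialize (hq m2 ltac:(lra)).
  assert (h := phi_nonincreasing q' q m2 ltac:(lra) ltac:(lra)).
  rewrite (phi_approx q) in h; lra.
Qed.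

Lemma crossing_between q :
  q1 < q < q2 ->
     exists x0,
       unique (fun x => 0 < x < PI / 2 /\ phi q x = 0) x0 /\
       (forall x, 0 < x < x0 -> sin x / x > approx q x) /\
       (forall x, x0 < x < PI / 2 -> sin x / x < approx q x).
Proof.
unfold q2; intros hq; assert (hb := q1_bounds).
destruct (shape_between q hq) as (m1 & m2 & x0 & hs & hx0 & hm2 & hz).
assert (h0 : 0 < m1) by apply hs.
assert (hp : forall x, 0 < x < x0 -> 0 < phi q x).
{ intros x hx; destruct (Rle_lt_dec x m1).
  - apply shape_pos with m1 m2; auto; lra.
  - rewrite <- hz; apply shape_falls with m1 m2; auto; lra. }
assert (hn : forall x, x0 < x < PI / 2 -> phi q x < 0).
{ intros x hx; destruct (Rle_lt_dec m2 x).
  - apply shape_neg with m1 m2; auto; lra.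
  - rewrite <- hz; apply shape_falls with m1 m2; auto; lra. }
exists x0; split; [split; [split; lra |] | split].
- intros x [hx hx'].
  destruct (Rtotal_order x0 x) as [h | [h | h]]; auto; exfalso.
  + specialize (hn x ltac:(lra)); lra.
  + specialize (hp x ltac:(lra)); lra.
- intros x hx; specialize (hp x hx); rewrite phi_approx in hp; lra.
- intros x hx; specialize (hn x hx); rewrite phi_approx in hn; lra.
Qed.

(** For q < 2 the inequality already fails at the maximum point of some [phi q']
    with q' in (q1, 2) and q <= q'. *)
Lemma inequality_from_q2 :
  (forall q, q2 <= q -> forall x, 0 < x < PI / 2 ->
      sin x / x < approx q2 x /\ approx q2 x <= approx q x) /\
   is_smallest
     (fun q => forall x, 0 < x < PI / 2 -> sin x / x < approx q x) q2.
Proof.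
unfold q2; assert (hb := q1_bounds).
assert (hneg : forall x, 0 < x < PI / 2 -> sin x / x < approx 2 x).
{ intros x hx; assert (h := phi_q2_neg x hx); rewrite phi_approx in h; lra. }
split; [| split; [exact hneg |]].
- intros q hq x hx; split; [auto |].
  assert (h := phi_nonincreasing 2 q x hx ltac:(lra)); rewrite !phi_approx in h; lra.
- intros q hq; apply Rnot_lt_le; intros hlt.
  set (q' := Rmax q ((q1 + 2) / 2)).
  assert (hq' : q' < 2 /\ q <= q' /\ (q1 + 2) / 2 <= q').
  { unfold q'; repeat split; [apply Rmax_lub_lt; lra | apply Rmax_l | apply Rmax_r]. }
  destruct (shape_between q' ltac:(lra)) as (m1 & m2 & x0 & hs & hx0 & hm2 & _).
  assert (h0 : 0 < m1) by apply hs.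
  assert (hp := shape_pos q' m1 m2 ltac:(lra) hs m1 ltac:(lra)).
  specialize (hq m1 ltac:(lra)).
  assert (h := phi_nonincreasing q q' m1 ltac:(lra) ltac:(lra)).
  rewrite (phi_approx q) in h; lra.
Qed.

(** * Uniqueness of the local extrema *)

Lemma not_max_if_right_greater (f : R -> R) a b m c :
  m < c -> (forall x, m < x < c -> f m < f x) -> ~ local_max_on a b f m.
Proof.
intros hc h [_ [d hd]].
assert (h0 := cond_pos d).
set (y := m + Rmin (d / 2) ((c - m) / 2)).
assert (hy : m < y /\ y <= m + d / 2 /\ y <= m + (c - m) / 2).
{ unfold y; assert (0 < Rmin (d / 2) ((c - m) / 2)) by (apply Rmin_glb_lt; lra).
  generalize (Rmin_l (d / 2) ((c - m) / 2)) (Rmin_r (d / 2) ((c - m) / 2)); lra. }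
assert (h1 := h y ltac:(lra)).
enough (f y <= f m) by lra.
apply hd; apply Rabs_lt_between'; simpl; lra.
Qed.

Lemma not_max_if_left_greater (f : R -> R) a b m c :
  c < m -> (forall x, c < x < m -> f m < f x) -> ~ local_max_on a b f m.
Proof.
intros hc h [_ [d hd]].
assert (h0 := cond_pos d).
set (y := m - Rmin (d / 2) ((m - c) / 2)).
assert (hy : y < m /\ m - d / 2 <= y /\ m - (m - c) / 2 <= y).
{ unfold y; assert (0 < Rmin (d / 2) ((m - c) / 2)) by (apply Rmin_glb_lt; lra).
  generalize (Rmin_l (d / 2) ((m - c) / 2)) (Rmin_r (d / 2) ((m - c) / 2)); lra. }
assert (h1 := h y ltac:(lra)).
enough (f y <= f m) by lra.
apply hd; apply Rabs_lt_between'; simpl; lra.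
Qed.

Lemma local_min_opp f a b m :
  local_min_on a b f m -> local_max_on a b (fun x => - f x) m.
Proof.
intros [h [d hd]]; split; auto; exists d; intros y hy; specialize (hd y hy); lra.
Qed.

Lemma locally_between (P : R -> Prop) a b x :
  a < x < b -> (forall y, a < y < b -> P y) -> locally x P.
Proof.
intros hx h.
assert (hd : 0 < Rmin (x - a) (b - x)) by (apply Rmin_glb_lt; lra).
exists (mkposreal _ hd); intros y hy; apply h.
apply Rabs_lt_between' in hy; simpl in hy.
generalize (Rmin_l (x - a) (b - x)) (Rmin_r (x - a) (b - x)); lra.
Qed.

Lemma shape_unique_max q m1 m2 :
  1 <= q -> shape q m1 m2 -> unique (local_max_on 0 (PI / 2) (phi q)) m1.
Proof.
intros hq hs; assert (h := hs); destruct h as (h1 & _).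
split.
- split; [lra |]; apply locally_between with 0 (PI / 2); [lra |].
  intros y hy; now apply shape_max with m2.
- intros m hm; assert (h := hm); destruct h as [h _].
  destruct (Rtotal_order m1 m) as [hl | [-> | hl]]; auto; exfalso; revert hm.
  + destruct (Rle_lt_dec m m2).
    * apply not_max_if_left_greater with m1; auto; intros x hx.
      apply shape_falls with m1 m2; auto; lra.
    * apply not_max_if_right_greater with (PI / 2); [lra |]; intros x hx.
      apply shape_rises_last with m1 m2; auto; lra.
  + apply not_max_if_right_greater with m1; auto; intros x hx.
    apply shape_rises_first with m1 m2; auto; lra.
Qed.

Lemma shape_unique_min q m1 m2 :
  1 <= q -> m2 < PI / 2 -> shape q m1 m2 ->
  unique (local_min_on 0 (PI / 2) (phi q)) m2.
Proof.
intros hq h2 hs; assert (h := hs); destruct h as (h1 & _).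
split.
- split; [lra |]; apply locally_between with 0 (PI / 2); [lra |].
  intros y hy; now apply shape_min with m1.
- intros m hm; assert (h := hm); destruct h as [h _]; apply local_min_opp in hm.
  destruct (Rtotal_order m2 m) as [hl | [-> | hl]]; auto; exfalso; revert hm.
  + apply not_max_if_left_greater with m2; auto; intros x hx.
    apply Ropp_lt_contravar, shape_rises_last with m1 m2; auto; lra.
  + destruct (Rle_lt_dec m m1).
    * apply not_max_if_left_greater with 0; [lra |]; intros x hx.
      apply Ropp_lt_contravar, shape_rises_first with m1 m2; auto; lra.
    * apply not_max_if_right_greater with m2; [lra |]; intros x hx.
      apply Ropp_lt_contravar, shape_falls with m1 m2; auto; lra.
Qed.

Lemma unique_min_q2 : exists! m, local_min_on 0 (PI / 2) (phi q2) m.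
Proof.
unfold q2; destruct shape_q2 as [m (h1 & h3 & h4)]; exists m.
assert (hde : forall x y, 0 < x -> x < y -> y <= m -> phi 2 y < phi 2 x).
{ intros x y hx hxy hy; apply phi_decreasing_on; auto; intros z hz; apply h3; lra. }
assert (hin : forall x y, m <= x -> x < y -> y <= PI / 2 -> phi 2 x < phi 2 y).
{ intros x y hx hxy hy; apply phi_increasing_on; try lra; intros z hz; apply h4; lra. }
split.
- split; [lra |]; apply locally_between with 0 (PI / 2); [lra |]; intros y hy.
  destruct (Rtotal_order y m) as [h | [-> | h]]; [left; apply hde | | left; apply hin]; lra.
- intros n hn; assert (h := hn); destruct h as [h _]; apply local_min_opp in hn.
  destruct (Rtotal_order m n) as [hl | [-> | hl]]; auto; exfalso; revert hn.
  + apply not_max_if_left_greater with m; auto; intros x hx.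
    apply Ropp_lt_contravar, hin; lra.
  + apply not_max_if_right_greater with m; auto; intros x hx.
    apply Ropp_lt_contravar, hde; lra.
Qed.

(** * The extremal values as functions of q *)

(** The supremum of a singleton is its element; this gives a description operator on
    the reals without choice. *)
Definition the_only (P : R -> Prop) : R := real (Lub_Rbar P).

Lemma the_only_unique (P : R -> Prop) (m : R) : unique P m -> the_only P = m.
Proof.
intros [hm hu]; unfold the_only.
rewrite (is_lub_Rbar_unique P (Finite m)); [reflexivity | split].
- intros x hx; rewrite (hu x hx); apply Rle_refl.
- intros b hb; now apply hb.
Qed.

Definition argmax (q : R) : R := the_only (local_max_on 0 (PI / 2) (phi q)).

Definition argmin (q : R) : R := the_only (local_min_on 0 (PI / 2) (phi q)).

Lemma arg_shape q :
  q1 < q < 2 -> shape q (argmax q) (argmin q) /\ argmin q < PI / 2.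
Proof.
intros hq; assert (hb := q1_bounds).
destruct (shape_between q hq) as (m1 & m2 & x0 & hs & _ & hm2 & _).
unfold argmax, argmin.
rewrite (the_only_unique _ m1) by (apply shape_unique_max with m2; auto; lra).
rewrite (the_only_unique _ m2) by (apply shape_unique_min with m1; auto; lra).
auto.
Qed.

Lemma arg_in_range q :
  q1 < q < 2 -> 0 < argmax q < PI / 2 /\ 0 < argmin q < PI / 2.
Proof.
intros hq; destruct (arg_shape q hq) as [(h & _) h2]; lra.
Qed.

Lemma phi_le_max q x : q1 < q < 2 -> 0 < x < PI / 2 -> phi q x <= phi q (argmax q).
Proof.
intros hq hx; assert (hb := q1_bounds); destruct (arg_shape q hq) as [h h2].
apply shape_max with (argmin q); auto; lra.
Qed.

Lemma phi_ge_min q x : q1 < q < 2 -> 0 < x < PI / 2 -> phi q (argmin q) <= phi q x.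
Proof.
intros hq hx; assert (hb := q1_bounds); destruct (arg_shape q hq) as [h h2].
apply shape_min with (argmax q); auto; lra.
Qed.

Lemma max_pos q : q1 < q < 2 -> 0 < phi q (argmax q).
Proof.
intros hq; assert (hb := q1_bounds); destruct (arg_shape q hq) as [h h2].
assert (h' := h); destruct h' as (h0 & _).
apply shape_pos with (argmax q) (argmin q); auto; lra.
Qed.

Lemma min_neg q : q1 < q < 2 -> phi q (argmin q) < 0.
Proof.
intros hq; assert (hb := q1_bounds); destruct (arg_shape q hq) as [h h2].
apply shape_neg with (argmax q) (argmin q); auto; lra.
Qed.

Lemma max_decreasing q q' :
  q1 < q -> q < q' -> q' < 2 -> phi q' (argmax q') < phi q (argmax q).
Proof.
intros h1 h2 h3; destruct (arg_in_range q' ltac:(lra)) as [hm _].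
apply Rlt_le_trans with (phi q (argmax q')).
- apply phi_decreasing; auto.
- apply phi_le_max; auto; lra.
Qed.

Lemma min_decreasing q q' :
  q1 < q -> q < q' -> q' < 2 -> phi q' (argmin q') < phi q (argmin q).
Proof.
intros h1 h2 h3; destruct (arg_in_range q ltac:(lra)) as [_ hm].
apply Rle_lt_trans with (phi q' (argmin q)).
- apply phi_ge_min; auto; lra.
- apply phi_decreasing; auto.
Qed.

Definition balance (q : R) : R := phi q (argmax q) + phi q (argmin q).

Lemma balance_decreasing q q' :
  q1 < q -> q < q' -> q' < 2 -> balance q' < balance q.
Proof.
intros h1 h2 h3; unfold balance.
assert (h4 := max_decreasing q q' h1 h2 h3); assert (h5 := min_decreasing q q' h1 h2 h3).
lra.
Qed.

Lemma balance_lipschitz q q' :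
  q1 < q -> q <= q' -> q' < 2 -> balance q - balance q' <= 2 * (q' - q).
Proof.
intros h1 h2 h3; assert (hb := q1_bounds); unfold balance.
destruct (arg_in_range q ltac:(lra)) as [hm _].
destruct (arg_in_range q' ltac:(lra)) as [_ hm'].
assert (a1 := phi_lipschitz q q' _ hm ltac:(lra) h2).
assert (a2 := phi_lipschitz q q' _ hm' ltac:(lra) h2).
assert (a3 := phi_le_max q' _ ltac:(lra) hm).
assert (a4 := phi_ge_min q _ ltac:(lra) hm').
lra.
Qed.

Lemma balance_continuous q : q1 < q < 2 -> continuity_pt balance q.
Proof.
intros hq eps he.
exists (Rmin (eps / 4) (Rmin (q - q1) (2 - q))); split.
{ repeat apply Rmin_glb_lt; lra. }
intros q' [_ hd]; simpl in hd |- *; unfold Rdist in *.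
assert (hd1 := Rlt_le_trans _ _ _ hd (Rmin_l _ _)).
assert (hd2 := Rlt_le_trans _ _ _ hd (Rmin_r _ _)).
assert (hd3 := Rlt_le_trans _ _ _ hd2 (Rmin_l _ _)).
assert (hd4 := Rlt_le_trans _ _ _ hd2 (Rmin_r _ _)).
apply Rabs_lt_between in hd1, hd3, hd4; apply Rabs_lt_between.
destruct (Rtotal_order q q') as [h | [<- | h]].
- assert (a1 := balance_lipschitz q q' ltac:(lra) ltac:(lra) ltac:(lra)).
  assert (a2 := balance_decreasing q q' ltac:(lra) ltac:(lra) ltac:(lra)); lra.
- lra.
- assert (a1 := balance_lipschitz q' q ltac:(lra) ltac:(lra) ltac:(lra)).
  assert (a2 := balance_decreasing q' q ltac:(lra) ltac:(lra) ltac:(lra)); lra.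
Qed.

Lemma abs_equal_iff_balance q :
  q1 < q < 2 ->
  (Rabs (phi q (argmax q)) = Rabs (phi q (argmin q)) <-> balance q = 0).
Proof.
intros hq; assert (h1 := max_pos q hq); assert (h2 := min_neg q hq); unfold balance.
rewrite Rabs_pos_eq, Rabs_left by lra; split; intros; lra.
Qed.

(** * Locating the extrema numerically *)

Definition scale : positive := (10 ^ 16)%positive.

(** Rounding keeps the numerators small in the Taylor polynomials evaluated at the
    result. *)
Definition round_lo (x : Q) : Q := Qfloor (x * (Zpos scale # 1)) # scale.

Definition round_hi (x : Q) : Q := (Qfloor (x * (Zpos scale # 1)) + 1) # scale.

Lemma round_bounds x : Q2R (round_lo x) <= Q2R x <= Q2R (round_hi x).
Proof.
assert (h1 := Qle_Rle _ _ (Qfloor_le (x * (Zpos scale # 1)))).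
assert (h2 := Rlt_le _ _ (Qlt_Rlt _ _ (Qlt_floor (x * (Zpos scale # 1))))).
unfold inject_Z in h1, h2; rewrite Q2R_mult, !Q2R_IZR in h1, h2.
assert (hs : 0 < IZR (Zpos scale)) by (apply IZR_lt; reflexivity).
split.
- change (IZR (Qfloor (x * (Zpos scale # 1))) / IZR (Zpos scale) <= Q2R x).
  apply Rle_div_l; assumption.
- change (Q2R x <= IZR (Qfloor (x * (Zpos scale # 1)) + 1) / IZR (Zpos scale)).
  apply -> Rle_div_r; assumption.
Qed.

Ltac q2r := repeat first
  [ rewrite Q2R_plus | rewrite Q2R_minus | rewrite Q2R_opp | rewrite Q2R_mult
  | rewrite Q2R_div by discriminate | rewrite Q2R_IZR ].

Definition point (r : R) : R := PI / 2 * exp (- r).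

Definition point_lo (r : Q) : Q := round_lo (pi_lo / 2 * exp_lo r).

Definition point_hi (r : Q) : Q := round_hi (pi_hi / 2 * exp_hi r).

Lemma point_bounds r :
  (0 <= r)%Q -> 0 <= Q2R (exp_lo r) ->
  Q2R (point_lo r) <= point (Q2R r) <= Q2R (point_hi r).
Proof.
intros hr he; assert (hpi := PI_bounds); assert (h := exp_bounds r hr).
assert (h3 := PI_gt_3); assert (hp := exp_pos (- Q2R r)).
assert (hpl : 3 <= Q2R pi_lo) by (unfold Q2R; simpl; lra).
split.
- apply Rle_trans with (1 := proj1 (round_bounds _)); q2r; apply Rmult_le_compat; lra.
- apply Rle_trans with (2 := proj2 (round_bounds _)); q2r; apply Rmult_le_compat; lra.
Qed.

Lemma sin_enclosure (xl xh : Q) (x : R) :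
  0 <= Q2R xl -> Q2R xl <= x <= Q2R xh -> Q2R xh <= PI / 2 ->
  Q2R (sin_lo xl) <= sin x <= Q2R (sin_hi xh).
Proof.
intros h0 hx hp; assert (h4 := PI_4); split.
- apply Rle_trans with (sin (Q2R xl)); [apply sin_bounds; lra | apply sin_incr_1; lra].
- apply Rle_trans with (sin (Q2R xh)); [apply sin_incr_1; lra | apply sin_bounds; lra].
Qed.

Lemma cos_enclosure (xl xh : Q) (x : R) :
  0 <= Q2R xl -> Q2R xl <= x <= Q2R xh -> Q2R xh <= PI / 2 ->
  Q2R (cos_lo xh) <= cos x <= Q2R (cos_hi xl).
Proof.
intros h0 hx hp; assert (h4 := PI_4); split.
- apply Rle_trans with (cos (Q2R xh)); [apply cos_bounds; lra | apply cos_decr_1; lra].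
- apply Rle_trans with (cos (Q2R xl)); [apply cos_decr_1; lra | apply cos_bounds; lra].
Qed.

Lemma slope_at_point q r :
  point r * slope q (point r)
  = (PI - 2) / 2 * q * exp (- ((1 + q) * r)) - sin (point r) + point r * cos (point r).
Proof.
assert (h := PI_gt_3); assert (he := exp_pos (- r)).
assert (hp : 0 < point r) by (apply Rmult_lt_0_compat; lra).
unfold slope, gap, tpow.
replace (2 * point r / PI) with (exp (- r)) by (unfold point; field; lra).
rewrite ln_exp; replace (- ((1 + q) * r)) with (- r + q * - r) by ring.
rewrite exp_plus.
replace (point r * _) with
  (point r * (q * (1 - 2 / PI) * exp (q * - r)) - sin (point r) + point r * cos (point r))
  by (field; lra).
unfold point at 1; field; lra.
Qed.

(** A lower bound of x times the slope at x = [point r], by [slope_at_point]. *)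
Definition slope_lo (q r : Q) : Q :=
  ((pi_lo - 2) / 2 * q * exp_lo ((1 + q) * r) - sin_hi (point_hi r)
   + point_lo r * cos_lo (point_hi r))%Q.

Definition slope_hi (q r : Q) : Q :=
  ((pi_hi - 2) / 2 * q * exp_hi ((1 + q) * r) - sin_lo (point_lo r)
   + point_hi r * cos_hi (point_lo r))%Q.

(** The point lies in (0, PI/2) and its cosine has a nonnegative lower bound, so that
    products of enclosures are products of their ends. *)
Definition in_range (q r : Q) : bool :=
  (Qle_bool 0 q && Qle_bool 0 r && Qle_bool 0 (exp_lo r)
   && Qlt_bool 0 (point_lo r) && Qlt_bool (point_hi r) (pi_lo / 2)
   && Qle_bool 0 (cos_lo (point_hi r)))%bool.

Lemma in_range_spec q r :
  in_range q r = true ->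
  0 <= Q2R q /\ (0 <= r)%Q /\ Q2R (point_lo r) <= point (Q2R r) <= Q2R (point_hi r) /\
  0 < Q2R (point_lo r) /\ Q2R (point_hi r) < PI / 2 /\ 0 <= Q2R (cos_lo (point_hi r)).
Proof.
unfold in_range; intros h.
apply andb_prop in h; destruct h as [h h6]; apply andb_prop in h; destruct h as [h h5].
apply andb_prop in h; destruct h as [h h4]; apply andb_prop in h; destruct h as [h h3].
apply andb_prop in h; destruct h as [h1 h2].
assert (hpi := PI_bounds).
apply Q2R_le_check in h1, h3, h6; apply Q2R_lt_check in h4, h5.
apply Qle_bool_iff in h2; revert h1 h3 h4 h5 h6; q2r; intros.
repeat split; try tauto; try lra; now apply point_bounds.
Qed.

Lemma slope_enclosure q r :
  in_range q r = true ->
  Q2R (slope_lo q r) <= point (Q2R r) * slope (Q2R q) (point (Q2R r)) <= Q2R (slope_hi q r).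
Proof.
intros h; destruct (in_range_spec q r h) as (hq & hr & hp & hp0 & hp2 & hc).
apply Qle_bool_iff in hr; assert (hr' := Q2R_le_check _ _ hr); apply Qle_bool_iff in hr.
rewrite Q2R_IZR in hr'.
assert (hs := sin_enclosure (point_lo r) (point_hi r) (point (Q2R r)) ltac:(lra) hp ltac:(lra)).
assert (hk := cos_enclosure (point_lo r) (point_hi r) (point (Q2R r)) ltac:(lra) hp ltac:(lra)).
assert (h1q : 0 <= Q2R ((1 + q) * r)) by (q2r; nra).
assert (hpi := PI_bounds); assert (h3 := PI_gt_3).
assert (he := exp_bounds ((1 + q) * r)
  ltac:(apply Rle_Qle; rewrite Q2R_IZR; exact h1q)).
assert (hep := exp_pos (- Q2R ((1 + q) * r))).
rewrite slope_at_point.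
replace ((1 + Q2R q) * Q2R r) with (Q2R ((1 + q) * r)) by (now q2r).
set (E := exp _) in *.
assert (hpl : 3 <= Q2R pi_lo) by (unfold Q2R; simpl; lra).
assert (hk0 : 0 <= cos (point (Q2R r))) by lra.
unfold slope_lo, slope_hi; q2r.
generalize dependent (cos (point (Q2R r))); generalize dependent (sin (point (Q2R r))).
generalize dependent (point (Q2R r)); intros p hp s hs k hk hk0.
set (c1 := Q2R (exp_lo _)) in *; set (c2 := Q2R (exp_hi _)) in *.
assert (0 <= (PI - 2) / 2 * Q2R q) by (apply Rmult_le_pos; lra).
split.
- assert ((Q2R pi_lo - 2) / 2 * Q2R q * c1 <= (PI - 2) / 2 * Q2R q * E).
  { apply Rle_trans with ((Q2R pi_lo - 2) / 2 * Q2R q * E).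
    - apply Rmult_le_compat_l; [apply Rmult_le_pos |]; lra.
    - apply Rmult_le_compat_r; [lra |]; apply Rmult_le_compat_r; lra. }
  assert (Q2R (point_lo r) * Q2R (cos_lo (point_hi r)) <= p * k)
    by (apply Rmult_le_compat; lra).
  lra.
- assert ((PI - 2) / 2 * Q2R q * E <= (Q2R pi_hi - 2) / 2 * Q2R q * c2).
  { apply Rle_trans with ((PI - 2) / 2 * Q2R q * c2).
    - apply Rmult_le_compat_l; lra.
    - apply Rmult_le_compat_r; [lra |]; apply Rmult_le_compat_r; lra. }
  assert (p * k <= Q2R (point_hi r) * Q2R (cos_hi (point_lo r)))
    by (apply Rmult_le_compat; lra).
  lra.
Qed.

Definition rises (q r : Q) : bool := (in_range q r && Qlt_bool 0 (slope_lo q r))%bool.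

Definition falls (q r : Q) : bool := (in_range q r && Qlt_bool (slope_hi q r) 0)%bool.

Lemma rises_spec q r :
  rises q r = true ->
  0 < slope (Q2R q) (point (Q2R r)) /\
  (0 < Q2R (point_lo r) <= point (Q2R r) /\
   point (Q2R r) <= Q2R (point_hi r) < PI / 2).
Proof.
intros h; apply andb_prop in h; destruct h as [h h'].
assert (he := slope_enclosure q r h); destruct (in_range_spec q r h) as (_ & _ & hp).
apply Q2R_lt_check in h'; rewrite Q2R_IZR in h'.
split; [| lra]; apply Rmult_lt_reg_l with (point (Q2R r)); lra.
Qed.

Lemma falls_spec q r :
  falls q r = true ->
  slope (Q2R q) (point (Q2R r)) < 0 /\
  (0 < Q2R (point_lo r) <= point (Q2R r) /\
   point (Q2R r) <= Q2R (point_hi r) < PI / 2).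
Proof.
intros h; apply andb_prop in h; destruct h as [h h'].
assert (he := slope_enclosure q r h); destruct (in_range_spec q r h) as (_ & _ & hp).
apply Q2R_lt_check in h'; rewrite Q2R_IZR in h'.
split; [| lra]; apply Rmult_lt_reg_l with (point (Q2R r)); lra.
Qed.

(** The equation [slope q m = 0] expresses t^q through sin m and cos m. *)
Lemma phi_at_critical q m :
  0 < m -> slope q m = 0 -> q * phi q m = (1 + q) * (sin m / m) - cos m - q.
Proof.
intros hm hs; rewrite phi_eq by lra; unfold slope, gap in hs; lra.
Qed.

Definition critical_value_lo (q xl xh : Q) : Q := ((1 + q) * (sin_lo xl / xh) - cos_hi xl - q)%Q.

Definition critical_value_hi (q xl xh : Q) : Q := ((1 + q) * (sin_hi xh / xl) - cos_lo xh - q)%Q.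

Lemma critical_value_enclosure q xl xh m :
  0 <= Q2R q -> 0 < Q2R xl -> 0 <= Q2R (sin_lo xl) ->
  Q2R xl <= m <= Q2R xh -> Q2R xh <= PI / 2 -> slope (Q2R q) m = 0 ->
  Q2R (critical_value_lo q xl xh) <= Q2R q * phi (Q2R q) m <= Q2R (critical_value_hi q xl xh).
Proof.
intros hq hl hsl hm hh hs.
rewrite phi_at_critical by (auto; lra).
assert (h1 := sin_enclosure xl xh m ltac:(lra) hm hh).
assert (h2 := cos_enclosure xl xh m ltac:(lra) hm hh).
assert (hn : forall x, 0 < Q2R x -> ~ (x == 0)%Q).
{ intros x hx e; apply Qeq_eqR in e; rewrite Q2R_IZR in e; lra. }
unfold critical_value_lo, critical_value_hi; rewrite !Q2R_minus, !Q2R_mult, !Q2R_plus, !Q2R_IZR.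
rewrite !Q2R_div by (apply hn; lra).
assert (Q2R (sin_lo xl) / Q2R xh <= sin m / m).
{ apply Rmult_le_compat; try lra; [left; apply Rinv_0_lt_compat; lra |].
  apply Rinv_le_contravar; lra. }
assert (sin m / m <= Q2R (sin_hi xh) / Q2R xl).
{ apply Rmult_le_compat; try lra; [left; apply Rinv_0_lt_compat; lra |].
  apply Rinv_le_contravar; lra. }
split; nra.
Qed.

(** As [point] decreases in its argument, the right end comes from [r] < [l]. *)
Lemma max_enclosure (q r l : Q) :
  (falls q r && rises q l
   && Qle_bool 0 (sin_lo (point_lo l)) && Qlt_bool r l)%bool = true ->
  q1 < Q2R q < 2 ->
  Q2R (critical_value_lo q (point_lo l) (point_hi r)) <= Q2R q * phi (Q2R q) (argmax (Q2R q))
    <= Q2R (critical_value_hi q (point_lo l) (point_hi r)).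
Proof.
intros h hq.
apply andb_prop in h; destruct h as [h h4]; apply andb_prop in h; destruct h as [h h3].
apply andb_prop in h; destruct h as [h1 h2].
apply falls_spec in h1; apply rises_spec in h2; apply Q2R_le_check in h3; apply Q2R_lt_check in h4.
rewrite Q2R_IZR in h3.
assert (hb := q1_bounds); destruct (arg_shape (Q2R q) hq) as [hs _].
assert (hlr : point (Q2R l) < point (Q2R r)).
{ assert (hPI := PI_gt_3); apply Rmult_lt_compat_l; [lra | apply exp_increasing; lra]. }
assert (hm := shape_localize_max _ _ _ (point (Q2R l)) (point (Q2R r)) hs
  ltac:(lra) hlr ltac:(lra) ltac:(tauto) ltac:(tauto)).
apply critical_value_enclosure; try lra; apply hs.
Qed.

Lemma min_enclosure (q r l : Q) :
  (rises q r && falls q l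
   && Qle_bool 0 (sin_lo (point_lo l)) && Qlt_bool r l)%bool = true ->
  q1 < Q2R q < 2 ->
  Q2R (critical_value_lo q (point_lo l) (point_hi r)) <= Q2R q * phi (Q2R q) (argmin (Q2R q))
    <= Q2R (critical_value_hi q (point_lo l) (point_hi r)).
Proof.
intros h hq.
apply andb_prop in h; destruct h as [h h4]; apply andb_prop in h; destruct h as [h h3].
apply andb_prop in h; destruct h as [h1 h2].
apply rises_spec in h1; apply falls_spec in h2; apply Q2R_le_check in h3; apply Q2R_lt_check in h4.
rewrite Q2R_IZR in h3.
assert (hb := q1_bounds); destruct (arg_shape (Q2R q) hq) as [hs _].
assert (hlr : point (Q2R l) < point (Q2R r)).
{ assert (hPI := PI_gt_3); apply Rmult_lt_compat_l; [lra | apply exp_increasing; lra]. }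
assert (hm := shape_localize_min _ _ _ (point (Q2R l)) (point (Q2R r)) hs
  ltac:(lra) hlr ltac:(lra) ltac:(tauto) ltac:(tauto)).
apply critical_value_enclosure; try lra; apply hs.
Qed.

(** The minimal error is 0.0026604429..., so near q0 the maximum and the minimum have
    to be compared to within 10^(-8). The two parameters are close enough to q0 for
    the extremal values there to give five digits of the error, and far enough for
    the maximum and the minimum to differ in absolute value by more than 7*10^(-8). *)
Definition qa : Q := 18482343 # 10000000.

Definition qb : Q := 1848236 # 1000000.

Definition ten_digits : positive := 10000000000%positive.

Lemma Q2R_qa : Q2R qa = 1.8482343.
Proof. unfold Q2R; simpl; lra. Qed.

Lemma Q2R_qb : Q2R qb = 1.848236.
Proof. unfold Q2R; simpl; lra. Qed.

(** The rationals r with the maximum point at (PI/2) exp(-r) are enclosed to about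
    10^(-9). The value is 0.002660479...; the common bound 0.00266045 in this and the
    next three lemmas separates the maximum from the absolute value of the minimum. *)
Lemma max_at_qa : 0.00266045 < phi 1.8482343 (argmax 1.8482343) < 0.0026605.
Proof.
assert (hb := q1_bounds); rewrite <- Q2R_qa.
assert (h := max_enclosure qa (11816109717 # ten_digits) (11816109727 # ten_digits)
  ltac:(vm_compute; reflexivity) ltac:(rewrite Q2R_qa; lra)).
assert (h1 := Q2R_lt_check (qa * (266045 # 100000000))
  (critical_value_lo qa (point_lo (11816109727 # ten_digits)) (point_hi (11816109717 # ten_digits)))
  ltac:(vm_compute; reflexivity)).
assert (h2 := Q2R_lt_check
  (critical_value_hi qa (point_lo (11816109727 # ten_digits)) (point_hi (11816109717 # ten_digits)))
  (qa * (26605 # 10000000)) ltac:(vm_compute; reflexivity)).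
rewrite Q2R_mult, !Q2R_frac, Q2R_qa in h1, h2; rewrite Q2R_qa in h |- *; lra.
Qed.

(** The value is -0.002660407.... *)
Lemma min_at_qa : -0.00266045 < phi 1.8482343 (argmin 1.8482343) < -0.0026604.
Proof.
assert (hb := q1_bounds); rewrite <- Q2R_qa.
assert (h := min_enclosure qa (1862271508 # ten_digits) (1862271519 # ten_digits)
  ltac:(vm_compute; reflexivity) ltac:(rewrite Q2R_qa; lra)).
assert (h1 := Q2R_lt_check (qa * (-266045 # 100000000))
  (critical_value_lo qa (point_lo (1862271519 # ten_digits)) (point_hi (1862271508 # ten_digits)))
  ltac:(vm_compute; reflexivity)).
assert (h2 := Q2R_lt_check
  (critical_value_hi qa (point_lo (1862271519 # ten_digits)) (point_hi (1862271508 # ten_digits)))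
  (qa * (-26604 # 10000000)) ltac:(vm_compute; reflexivity)).
rewrite Q2R_mult, !Q2R_frac, Q2R_qa in h1, h2; rewrite Q2R_qa in h |- *; lra.
Qed.

(** The value is 0.002660397.... *)
Lemma max_at_qb : phi 1.848236 (argmax 1.848236) < 0.00266045.
Proof.
assert (hb := q1_bounds); rewrite <- Q2R_qb.
assert (h := max_enclosure qb (11816213418 # ten_digits) (11816213428 # ten_digits)
  ltac:(vm_compute; reflexivity) ltac:(rewrite Q2R_qb; lra)).
assert (h2 := Q2R_lt_check
  (critical_value_hi qb (point_lo (11816213428 # ten_digits)) (point_hi (11816213418 # ten_digits)))
  (qb * (266045 # 100000000)) ltac:(vm_compute; reflexivity)).
rewrite Q2R_mult, !Q2R_frac, Q2R_qb in h2; rewrite Q2R_qb in h |- *; lra.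
Qed.

(** The value is -0.002660488.... *)
Lemma min_at_qb : phi 1.848236 (argmin 1.848236) < -0.00266045.
Proof.
assert (hb := q1_bounds); rewrite <- Q2R_qb.
assert (h := min_enclosure qb (1862300771 # ten_digits) (1862300781 # ten_digits)
  ltac:(vm_compute; reflexivity) ltac:(rewrite Q2R_qb; lra)).
assert (h2 := Q2R_lt_check
  (critical_value_hi qb (point_lo (1862300781 # ten_digits)) (point_hi (1862300771 # ten_digits)))
  (qb * (-266045 # 100000000)) ltac:(vm_compute; reflexivity)).
rewrite Q2R_mult, !Q2R_frac, Q2R_qb in h2; rewrite Q2R_qb in h |- *; lra.
Qed.

Lemma balance_root :
  exists q0, 1.8482343 < q0 < 1.848236 /\ balance q0 = 0.
Proof.
assert (hb := q1_bounds).
assert (h1 := max_at_qa); assert (h2 := min_at_qa).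
assert (h3 := max_at_qb); assert (h4 := min_at_qb).
assert (ha : 0 < balance 1.8482343) by (unfold balance; lra).
assert (hb' : balance 1.848236 < 0) by (unfold balance; lra).
destruct (IVT_interv (fun q => - balance q) 1.8482343 1.848236) as [q0 [hq0 hz]]; try lra.
{ intros a h; apply continuity_pt_opp, balance_continuous; lra. }
exists q0; split; [| lra].
split; apply Rnot_le_lt; intros h.
- replace q0 with 1.8482343 in hz by lra; lra.
- replace q0 with 1.848236 in hz by lra; lra.
Qed.

Definition ln_pi_lo : Q := 11447298 # 10000000.

Definition ln_pi_hi : Q := 11447299 # 10000000.

(** Six decimals suffice: for the parameters q in question, A q stays below
    0.0438039, hence below 0.043804 by a relative margin of 2*10^(-6). *)
Lemma ln_PI_bounds : Q2R ln_pi_lo < ln PI < Q2R ln_pi_hi.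
Proof.
assert (hPI := PI_approx).
assert (hl := exp_bounds ln_pi_lo ltac:(discriminate)).
assert (hh := exp_bounds ln_pi_hi ltac:(discriminate)).
assert (h1 := Q2R_lt_check (1 / (3141592653589 # 1000000000000)) (exp_lo ln_pi_lo) ltac:(vm_compute; reflexivity)).
assert (h2 := Q2R_lt_check (exp_hi ln_pi_hi) (1 / (314159265359 # 100000000000)) ltac:(vm_compute; reflexivity)).
rewrite Q2R_div, Q2R_IZR, Q2R_frac in h1, h2 by discriminate.
assert (e : exp (- ln PI) = 1 / PI) by (rewrite exp_Ropp, exp_ln by lra; field; lra).
split; apply Ropp_lt_cancel, exp_lt_inv; rewrite e.
- apply Rlt_le_trans with (2 := proj1 hl); apply Rlt_trans with (2 := h1).
  apply Rmult_lt_compat_l, Rinv_lt_contravar; nra.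
- apply Rle_lt_trans with (1 := proj2 hh); apply Rlt_trans with (1 := h2).
  apply Rmult_lt_compat_l, Rinv_lt_contravar; nra.
Qed.

Lemma A_eq q : A q = (1 - 2 / PI) * exp (- (q * ln PI)).
Proof.
assert (hPI := PI_gt_3); unfold A, Rpower.
rewrite exp_Ropp; replace ((q + 1) * ln PI) with (q * ln PI + ln PI) by ring.
rewrite exp_plus, exp_ln by lra.
assert (h := exp_pos (q * ln PI)); field; lra.
Qed.

Lemma A_bounds q : 1.8482343 <= q <= 1.848236 -> 0.043803 <= A q < 0.043804.
Proof.
intros hq; assert (hPI := PI_approx); assert (hl := ln_PI_bounds); rewrite A_eq.
assert (hc : 0.363380 < 1 - 2 / PI < 0.363381).
{ assert (0.636619 < 2 / PI < 0.63662); [split; [apply -> Rlt_div_r | apply <- Rlt_div_l]; lra | lra]. }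
assert (hl0 : 1 < Q2R ln_pi_lo) by (unfold Q2R; simpl; lra).
assert (h1 := exp_bounds (qa * ln_pi_lo) ltac:(discriminate)).
assert (h2 := exp_bounds (qb * ln_pi_hi) ltac:(discriminate)).
rewrite Q2R_mult, Q2R_qa in h1; rewrite Q2R_mult, Q2R_qb in h2.
assert (h3 := Q2R_lt_check ((363381 # 1000000) * exp_hi (qa * ln_pi_lo)) (43804 # 1000000)
  ltac:(vm_compute; reflexivity)).
assert (h4 := Q2R_lt_check (43803 # 1000000) ((363380 # 1000000) * exp_lo (qb * ln_pi_hi))
  ltac:(vm_compute; reflexivity)).
rewrite Q2R_mult, !Q2R_frac in h3, h4.
assert (exp (- (q * ln PI)) <= exp (- (1.8482343 * Q2R ln_pi_lo)))
  by (left; apply exp_increasing; nra).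
assert (exp (- (1.848236 * Q2R ln_pi_hi)) <= exp (- (q * ln PI)))
  by (left; apply exp_increasing; nra).
assert (h0 := exp_pos (- (q * ln PI))).
split; nra.
Qed.

(** * The minimax property *)

Lemma sup_error_eq (f : R -> R) a b x d :
  a < x < b -> Rabs (f x) = d -> (forall y, a < y < b -> Rabs (f y) <= d) ->
  sup_error a b f = Finite d.
Proof.
intros hx hd h; apply is_lub_Rbar_unique; split.
- intros e [y [hy ->]]; now apply h.
- intros l hl; apply hl; now exists x.
Qed.

Lemma sup_error_gt (f : R -> R) a b x d :
  a < x < b -> d < Rabs (f x) -> Rbar_lt (Finite d) (sup_error a b f).
Proof.
intros hx hd; unfold sup_error.
apply Rbar_lt_le_trans with (Finite (Rabs (f x))); [exact hd |].
apply Lub_Rbar_correct; now exists x.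
Qed.

(** For q < q0 the error is larger at the maximum point of [phi q0], for q > q0 at
    its minimum point. *)
Lemma error_gt_elsewhere q0 q :
  q1 < q0 < 2 -> balance q0 = 0 -> 0 < q -> q <> q0 ->
  Rbar_lt (Finite (phi q0 (argmax q0))) (sup_error 0 (PI / 2) (phi q)).
Proof.
intros hq0 hz hq hn; assert (h1 := max_pos q0 hq0); unfold balance in hz.
destruct (arg_in_range q0 hq0) as [hx hy].
destruct (Rtotal_order q q0) as [h | [h | h]]; [| easy |].
- apply sup_error_gt with (argmax q0); auto.
  assert (h2 := phi_decreasing q q0 _ hx h); rewrite Rabs_pos_eq; lra.
- apply sup_error_gt with (argmin q0); auto.
  assert (h2 := phi_decreasing q0 q _ hy h); rewrite Rabs_left; lra.
Qed.

Lemma sup_error_balanced q0 :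
  q1 < q0 < 2 -> balance q0 = 0 ->
  sup_error 0 (PI / 2) (phi q0) = Finite (phi q0 (argmax q0)).
Proof.
intros hq0 hz; assert (h1 := max_pos q0 hq0); unfold balance in hz.
destruct (arg_in_range q0 hq0) as [hx hy].
apply sup_error_eq with (argmax q0); auto; [apply Rabs_pos_eq; lra |].
intros y h; assert (h2 := phi_le_max q0 y hq0 h); assert (h3 := phi_ge_min q0 y hq0 h).
apply Rabs_le; lra.
Qed.

Lemma inf_error_balanced q0 :
  q1 < q0 < 2 -> balance q0 = 0 ->
  inf_error 0 (PI / 2) phi = Finite (phi q0 (argmax q0)).
Proof.
intros hq0 hz; assert (hb := q1_bounds).
assert (hs := sup_error_balanced q0 hq0 hz).
apply Rbar_is_glb_unique; split.
- intros d [q [hq ->]].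
  destruct (Req_dec q q0) as [-> | hn]; [rewrite hs; apply Rbar_le_refl |].
  now apply Rbar_lt_le, error_gt_elsewhere.
- intros b h; apply h; exists q0; split; [lra | now symmetry].
Qed.

Theorem mainTheorem2 :
  (1.75193 <= q1 < 1.75194) /\
  (* (i) *)
  ((forall q, 0 < q <= q1 -> forall x, 0 < x < PI / 2 ->
      sin x / x > approx q1 x /\ approx q1 x >= approx q x) /\
   is_largest
     (fun q => forall x, 0 < x < PI / 2 -> sin x / x > approx q x) q1) /\
  (* (ii) *)
  (forall q, q1 < q < q2 ->
     exists x0,
       unique (fun x => 0 < x < PI / 2 /\ phi q x = 0) x0 /\
       (forall x, 0 < x < x0 -> sin x / x > approx q x) /\
       (forall x, x0 < x < PI / 2 -> sin x / x < approx q x)) /\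
  (* (iii) *)
  ((forall q, q2 <= q -> forall x, 0 < x < PI / 2 ->
      sin x / x < approx q2 x /\ approx q2 x <= approx q x) /\
   is_smallest
     (fun q => forall x, 0 < x < PI / 2 -> sin x / x < approx q x) q2) /\
  (exists m1 m2 : R -> R,
    (* (iv) *)
    ((forall q, q1 < q < q2 ->
        unique (local_max_on 0 (PI / 2) (phi q)) (m1 q) /\
        unique (local_min_on 0 (PI / 2) (phi q)) (m2 q) /\
        m1 q < m2 q) /\
     (exists! m, local_max_on 0 (PI / 2) (phi q1) m) /\
     (exists! m, local_min_on 0 (PI / 2) (phi q2) m)) /\
    (* (v) *)
    (exists q0 d0 : R,
       unique (fun q => q1 < q < q2 /\
                 Rabs (phi q (m1 q)) = Rabs (phi q (m2 q))) q0 /\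
       1.84823 <= q0 < 1.84824 /\
       d0 = Rabs (phi q0 (m1 q0)) /\
       d0 = Rabs (phi q0 (m2 q0)) /\
       0.0026604 <= d0 < 0.0026605 /\
       Finite d0 = inf_error 0 (PI / 2) phi /\
       sup_error 0 (PI / 2) (phi q0) = inf_error 0 (PI / 2) phi /\
       (forall g : R -> R,
          minimax_approximant 0 (PI / 2) phi g <->
          (forall x, 0 < x < PI / 2 ->
             g x = sin x / x - 2 / PI
                   - A q0 * (Rpower PI q0 - Rpower (2 * x) q0))) /\
       0.043803 <= A q0 < 0.043804)).
Proof.
assert (hb := q1_bounds).
split; [exact hb | split; [exact inequality_upto_q1 | split; [exact crossing_between | split; [exact inequality_from_q2 |]]]].
exists argmax, argmin; split; [split; [| split] |].
- unfold q2; intros q hq; destruct (arg_shape q hq) as [hs h2]; split; [| split].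
  + apply shape_unique_max with (argmin q); auto; lra.
  + apply shape_unique_min with (argmax q); auto; lra.
  + apply hs.
- destruct shape_q1 as [m [_ hs]]; exists m.
  apply shape_unique_max with (PI / 2); auto; lra.
- exact unique_min_q2.
- destruct balance_root as [q0 [hq hz]].
  assert (hq0 : q1 < q0 < 2) by lra.
  assert (hz' := hz); unfold balance in hz'.
  assert (h1 := max_pos q0 hq0); assert (h2 := min_neg q0 hq0).
  assert (hinf := inf_error_balanced q0 hq0 hz).
  assert (hsup := sup_error_balanced q0 hq0 hz).
  exists q0, (phi q0 (argmax q0)); unfold q2; repeat apply conj.
  + lra.
  + lra.
  + now apply abs_equal_iff_balance.
  + intros q [hq' he]; apply abs_equal_iff_balance in he; auto.
    destruct (Rtotal_order q0 q) as [h | [h | h]]; auto; exfalso.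
    * assert (h' := balance_decreasing q0 q ltac:(lra) h ltac:(lra)); lra.
    * assert (h' := balance_decreasing q q0 ltac:(lra) h ltac:(lra)); lra.
  + lra.
  + lra.
  + rewrite Rabs_pos_eq; lra.
  + rewrite Rabs_left; lra.
  + assert (h := min_decreasing 1.8482343 q0 ltac:(lra) ltac:(lra) ltac:(lra)).
    assert (h' := min_at_qa); lra.
  + assert (h := max_decreasing 1.8482343 q0 ltac:(lra) ltac:(lra) ltac:(lra)).
    assert (h' := max_at_qa); lra.
  + now symmetry.
  + congruence.
  + intros g; split.
    * intros (q & hq' & he & hg).
      destruct (Req_dec q q0) as [-> | hn]; [exact hg | exfalso].
      assert (h := error_gt_elsewhere q0 q hq0 hz hq' hn).
      rewrite he, hinf in h; exact (Rlt_irrefl _ h).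
    * intros hg; exists q0; split; [lra | split; [congruence | exact hg]].
  + apply A_bounds; lra.
  + apply A_bounds; lra.
Qed.
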